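(* The class $\overline{\mathcal B}$ has the lift property relative to the class $\mathcal B$ of all finite bowtie-free graphs. That is, for every $\mathbf A\in\mathcal B$ there is $\mathbf B\in\mathcal B$ such that for all $\mathbf A^+,\mathbf B^+\in\overline{\mathcal B}$ such that the shadow of $\mathbf A^+$ is $\mathbf A$ and the shadow of $\mathbf B^+$ is $\mathbf B$, there is an embedding of $\mathbf A^+$ into $\mathbf B^+$.
   Context: Graphs are finite, simple and undirected. A bowtie is the graph consisting of two triangles sharing exactly one vertex; a graph is bowtie-free if it has no (not necessarily induced) subgraph isomorphic to a bowtie. For $n\ge 2$ the chimney $Ch_n$ is the graph formed by $n$ triangles sharing one common edge (and otherwise disjoint, with no further edges). A bowtie-free graph is good if every vertex is contained in an induced copy of some chimney or in a copy of $K_4$. For a graph $G=(V,E)$, $E_0(G)$ is the set of edges lying in triangles and $E_1(G)=E\setminus E_0(G)$. For a good bowtie-free graph, a vertex is central if it lies in at least two triangles, and non-central otherwise; the centre $c(v)$ of a vertex $v$ is the subgraph induced by all central vertices in the connected component of $(V,E_0)$ containing $v$ (it is either the common edge of a chimney or a $K_4$). Lift $L_0$: an ordered good bowtie-free graph is a structure $\mathbf G=(V,R^{E_0},R^{E_1},\le_{\mathbf G})$ where $G=(V,E)$ is a good bowtie-free graph, $R^{E_0}=E_0(G)$, $R^{E_1}=E_1(G)$ (as symmetric binary relations), and $\le_{\mathbf G}$ is an admissible ordering, i.e. a linear order of $V$ such that: (1) the vertices of the centre of every vertex form an interval; (2) all centres of chimneys come before vertices in copies of $K_4$; (3) all central vertices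 come before non-central vertices; (4) the non-central vertices belonging to a given chimney form an interval, and the relative order of these intervals follows the relative order of the corresponding centres. $\mathcal B_0$ is the class of all ordered good bowtie-free graphs. Lift $L_1$: for $\mathbf G\in\mathcal B_0$, $L_1(\mathbf G)$ adds unary relations $R^\ell,R^r,R^1,R^2,R^3,R^4$: for every pair $u<_{\mathbf G}v$ forming the centre of a chimney put $u\in R^\ell$, $v\in R^r$; for all $a<_{\mathbf G}b<_{\mathbf G}c<_{\mathbf G}d$ that are the vertices of a copy of $K_4$ put $a\in R^1$, $b\in R^2$, $c\in R^3$, $d\in R^4$. Lift $L_2$: for distinct vertices $u,v$ of $\mathbf G\in\mathcal B_0$, let $t(u,v)$ be the isomorphism type of the structure induced by $L_1(\mathbf G)$ on $\{u,v\}\cup c(u)\cup c(v)$, rooted at $(u,v)$ (isomorphisms preserve the ordered pair of roots). Let $t_1,\dots,t_N$ enumerate all (finitely many) possible such types. $L_2(\mathbf G)$ is $L_1(\mathbf G)$ with additional binary relations $R^{t_1},\dots,R^{t_N}$, where for $u<_{\mathbf G}v$ we put $(u,v)\in R^{t(u,v)}$ (and no other tuples). $\mathcal B_2$ is the class of all $L_2(\mathbf G)$, $\mathbf G\in\mathcal B_0$, and $\overline{\mathcal B}$ is the class of all (induced) substructures of structures in $\mathcal B_2$. The shadow of $\mathbf A^+\in\overline{\mathcal B}$ is the graph on the same vertex set with edge set $R^{E_0}_{\mathbf A^+}\cup R^{E_1}_{\mathbf A^+}$. An embedding of structures is an injective map preserving and reflecting all relations. *)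

(* Defs.v *)
From mathcomp Require Import all_boot boolp.

Set Implicit Arguments.
Unset Strict Implicit.
Unset Printing Implicit Defensive.

(* Graphs *)

Record sgraph (V : Type) := SGraph {
  adj :> rel V;
  adj_sym : symmetric adj;
  adj_irr : irreflexive adj }.

(* [f] identifies [H] with a (not necessarily induced) subgraph of [G]. *)
Definition copy (V W : Type) (H : sgraph V) (G : sgraph W) (f : V -> W) : Prop :=
  injective f /\ forall x y, H x y -> G (f x) (f y).

Definition induced_copy (V W : Type) (H : sgraph V) (G : sgraph W)
    (f : V -> W) : Prop :=
  injective f /\ forall x y, G (f x) (f y) = H x y.

(* [None] is the shared vertex; [Some (i, false)] and [Some (i, true)] are the
   two other vertices of the [i]-th triangle. *)
Definition bowtie_adj : rel (option (bool * bool)) := fun x y =>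
  match x, y with
  | None, None => false
  | Some p, Some q => (p.1 == q.1) && (p.2 != q.2)
  | _, _ => true
  end.

Lemma bowtie_sym : symmetric bowtie_adj.
Proof. by move=> [[[] []]|] [[[] []]|]. Qed.

Lemma bowtie_irr : irreflexive bowtie_adj.
Proof. by move=> [[[] []]|]. Qed.

Definition bowtie : sgraph (option (bool * bool)) :=
  SGraph bowtie_sym bowtie_irr.

(* The common edge joins [inr false] to [inr true]; [inl i] is the apex of the
   [i]-th triangle. *)
Definition chimney_adj (n : nat) : rel ('I_n + bool) := fun x y =>
  match x, y with
  | inl _, inl _ => false
  | inr a, inr b => a != b
  | _, _ => true
  end.

Lemma chimney_sym n : symmetric (@chimney_adj n).
Proof. by move=> [i|[]] [j|[]]. Qed.

Lemma chimney_irr n : irreflexive (@chimney_adj n).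
Proof. by move=> [i|[]]. Qed.

Definition chimney (n : nat) : sgraph ('I_n + bool) :=
  SGraph (@chimney_sym n) (@chimney_irr n).

Definition K4_adj : rel 'I_4 := fun i j => i != j.

Lemma K4_sym : symmetric K4_adj.
Proof. by move=> i j; rewrite /K4_adj eq_sym. Qed.

Lemma K4_irr : irreflexive K4_adj.
Proof. by move=> i; rewrite /K4_adj eqxx. Qed.

Definition K4 : sgraph 'I_4 := SGraph K4_sym K4_irr.

Definition bowtie_free (V : Type) (G : sgraph V) : Prop :=
  ~ exists f, copy bowtie G f.

Definition in_chimney (V : Type) (G : sgraph V) (v : V) : Prop :=
  exists n (f : 'I_n + bool -> V),
    [/\ 1 < n, induced_copy (chimney n) G f & exists x, f x = v].

Definition in_K4 (V : Type) (G : sgraph V) (v : V) : Prop :=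
  exists f, copy K4 G f /\ exists i, f i = v.

Definition good (V : Type) (G : sgraph V) : Prop :=
  bowtie_free G /\ forall v, in_chimney G v \/ in_K4 G v.

(* [u] and [v] are, in this order, the ends of the common edge of an induced
   chimney; the relation is symmetric. Inducedness excludes edges of a K_4. *)
Definition chimney_centre (V : Type) (G : sgraph V) (u v : V) : Prop :=
  exists n (f : 'I_n + bool -> V),
    [/\ 1 < n, induced_copy (chimney n) G f, f (inr false) = u
      & f (inr true) = v].

Section Centres.
Variables (V : finType) (G : sgraph V).

Definition edge0 : rel V := fun u v => G u v && [exists w, G u w && G v w].
Definition edge1 : rel V := fun u v => G u v && ~~ edge0 u v.

Definition triangles : {set {set V}} :=
  [set T : {set V} | (#|T| == 3)
     && [forall x in T, forall y in T, (x != y) ==> G x y]].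

Definition central (v : V) : bool :=
  1 < #|[set T in triangles | v \in T]|.

Definition centre (v : V) : {set V} :=
  [set u | central u & connect edge0 v u].

End Centres.

(* Admissible orderings *)

Definition strict (V : eqType) (le : rel V) : rel V :=
  fun x y => (x != y) && le x y.

Definition interval (V : finType) (le : rel V) (S : {set V}) : Prop :=
  forall x y z, x \in S -> z \in S -> le x y -> le y z -> y \in S.

Definition linear_order (V : Type) (le : rel V) : Prop :=
  [/\ reflexive le, antisymmetric le, transitive le & total le].

(* Chimneys in the last two clauses are the maximal ones: their non-central
   vertices are exactly those with a prescribed centre. *)
Record admissible (V : finType) (G : sgraph V) (le : rel V) : Prop := {
  adm_linear : linear_order le;
  adm_centre : forall v, interval le (centre G v);
  adm_chimney_K4 : forall x x' y,
    chimney_centre G x x' -> in_K4 G y -> strict le x y;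
  adm_central : forall x y, central G x -> ~~ central G y -> strict le x y;
  adm_noncentral : forall v,
    interval le [set w | ~~ central G w & centre G w == centre G v];
  adm_noncentral_order : forall v w x y,
    ~~ central G v -> ~~ central G w -> centre G v != centre G w ->
    x \in centre G v -> y \in centre G w -> strict le x y -> strict le v w }.

(* Membership of (V, E_0(G), E_1(G), le) in the class B_0. *)
Definition ordered_good (V : finType) (G : sgraph V) (le : rel V) : Prop :=
  good G /\ admissible G le.

(* Relational structures *)

(* Structures on [V] with unary symbols [U] and binary symbols [B]. *)
Record structure (U B V : Type) := Structure {
  un : U -> pred V;
  bin : B -> rel V }.

Definition embedding (U B V W : Type) (M : structure U B V)
    (N : structure U B W) (f : V -> W) : Prop :=
  [/\ injective f, forall s x, un N s (f x) = un M s x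
    & forall s x y, bin N s (f x) (f y) = bin M s x y].

Definition induced (U B : Type) (V : finType) (M : structure U B V)
    (S : {set V}) : structure U B {x | x \in S} :=
  Structure (fun s x => un M s (val x)) (fun s x y => bin M s (val x) (val y)).

(* The lift L_1 *)

(* [RK i] is the relation R^{i+1}. *)
Inductive unary_symbol := Rl | Rr | RK of 'I_4.
Inductive binary_symbol := RE0 | RE1 | Rle.

Definition structure1 := structure unary_symbol binary_symbol.

Definition L1 (V : finType) (G : sgraph V) (le : rel V) : structure1 V :=
  Structure
    (fun s x => match s with
       | Rl => `[< exists v, strict le x v /\ chimney_centre G x v >]
       | Rr => `[< exists u, strict le u x /\ chimney_centre G u x >]
       | RK i => `[< exists f, [/\ copy K4 G f,
                       forall j k : 'I_4, j < k -> strict le (f j) (f k)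
                     & f i = x] >]
       end)
    (fun s => match s with
       | RE0 => edge0 G
       | RE1 => edge1 G
       | Rle => le
       end).

(* The lift L_2 *)

Record rooted (V : Type) := Rooted {
  rooted_str : structure1 V;
  root1 : V;
  root2 : V }.

Definition rooted_iso (V W : Type) (M : rooted V) (N : rooted W) : Prop :=
  exists f : V -> W,
    [/\ bijective f, embedding (rooted_str M) (rooted_str N) f, f (root1 M) = root1 N
      & f (root2 M) = root2 N].

Section PairType.
Variables (V : finType) (G : sgraph V) (le : rel V) (u v : V).

Definition pair_support : {set V} := [set u; v] :|: centre G u :|: centre G v.

Lemma pair_support1 : u \in pair_support.
Proof. by rewrite !inE eqxx. Qed.

Lemma pair_support2 : v \in pair_support.
Proof. by rewrite !inE eqxx orbT. Qed.

Definition pair_rooted : rooted {x | x \in pair_support} :=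
  Rooted (induced (L1 G le) pair_support)
    (exist _ u pair_support1) (exist _ v pair_support2).

End PairType.

(* A finite linearly ordered structure is isomorphic to exactly one structure
   whose carrier is some 'I_n with its natural order. Isomorphism types are
   represented by these, and only the types that do occur are kept. *)
Definition possible_type (t : {n : nat & rooted 'I_n}) : Prop :=
  (forall i j, bin (rooted_str (tagged t)) Rle i j = (i <= j)) /\
  exists (V : finType) (G : sgraph V) (le : rel V) (u v : V),
    [/\ ordered_good G le, u != v
      & rooted_iso (pair_rooted G le u v) (tagged t)].

Definition pair_type : Type := {t : {n : nat & rooted 'I_n} | possible_type t}.

Definition structure2 := structure unary_symbol (binary_symbol + pair_type).

Definition L2 (V : finType) (G : sgraph V) (le : rel V) : structure2 V :=
  Structure
    (un (L1 G le))
    (fun s => match s with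
       | inl b => bin (L1 G le) b
       | inr t => fun u v => strict le u v
           && `[< rooted_iso (pair_rooted G le u v) (tagged (sval t)) >]
       end).

(* The class of induced substructures of L_2-lifts, closed under isomorphism. *)
Definition in_Bbar (V : finType) (M : structure2 V) : Prop :=
  exists (W : finType) (G : sgraph W) (le : rel W) (f : V -> W),
    ordered_good G le /\ embedding M (L2 G le) f.

Definition shadow (V : Type) (M : structure2 V) : rel V :=
  fun x y => bin M (inl RE0) x y || bin M (inl RE1) x y.

(* Main.v *)
Require Import Defs.
From mathcomp Require Import all_boot perm boolp.
Set Implicit Arguments.
Unset Strict Implicit.
Unset Printing Implicit Defensive.

(** In a bowtie-free graph two triangles with a common vertex have a second
common vertex.  Hence the component of (V, E_0) of a vertex of a K_4 is that
K_4, and the component of a vertex of an induced chimney with two apexes [y]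
and [z] over the edge [l r] consists of [l], [r] and their common neighbours.
In both cases a few vertices near a given one already decide what its centre is.
So when a good graph [H] is an induced subgraph of a good graph [G], nothing
outside [H] changes the E_0-edges, the centres or the admissibility of an order,
and [L2] of [H] is the substructure induced by [L2] of [G] ([L2_map],
[admissible_map]).  A lift [Ap] is an induced substructure of some [L2 G_A le];
picking four vertices around each vertex of [Ap] gives a good induced subgraph
[H] of [G_A] with at most [4 * #|V|] vertices whose [L2] contains [Ap]
([exists_small_good_subgraph]).  It remains to find a bowtie-free [B] such that,
for each admissible order on a good graph containing [B], each ordered good [H]
of that size has an order-preserving induced copy in [B].

Without its E_1-edges such an [H] is easily located.  Let [slot n] be the vertex
set of [n.+2] disjoint chimneys with [n.+2] apexes each and [n.+2] disjoint
copies of K_4.  Admissibility says that vertices are sorted first by kind, then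
by the rank of their centre, then by their position in its group; so the slots,
under whatever admissible order, contain an ordered copy of [H] minus its
E_1-edges ([exists_block_embedding]).  Which pairs of slots have to become
E_1-edges depends on the order that the slots receive, and this order is chosen
after [B].

[B] is therefore made of many copies of the slots, glued along whole blocks
(chimneys or K_4s) as prescribed by a hypergraph: its vertices stand for blocks,
each hyperedge for one copy of the slots.  A hyperedge carries a guess [L] of the
order on its copy and a function [d] from orders to sets of E_1-edges, and the
E_1-edges put on the copy are [d L].  The hypergraph is such that for each
order on the vertices of [B] and each [d] there is a hyperedge with label [d]
whose guess is right ([exists_forcing_hgraph]).  For given [Ap], let [d] send an
order to the E_1-edges of [H] along an embedding for this order: the copy with the
right guess contains [H].

Moreover two hyperedges share at most one vertex, and no three of them form a
triangle.  So a triangle of [B] with an E_1-edge would lie in one copy of the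
slots, where the E_1-edges, copied from [H], lie in no triangle.  The triangles of
[B] are those of its blocks and [B] is bowtie-free ([target_bowtie_free]).  *)

(** * Hypergraphs whose labels predict orders *)

Section Hypergraphs.
Variables (I : eqType) (P D : finType) (pos : P -> I).

(** An edge [e] contains the vertex [(i, inc e i)] for each position [i]: the
vertices at different positions are distinct even if they are given by the same
point.  Partiteness is thus built in.  The first component of a label is a guess
about an order on [P], as a set of pairs [(u, v)] with [u] below [v]. *)
Record hgraph := HGraph {
  point : finType;
  hedge : finType;
  inc : hedge -> I -> point;
  lab : hedge -> {set P * P} * D }.

Definition linear_hgraph (S : hgraph) := forall (e f : hedge S) a b,
  a != b -> inc e a = inc f a -> inc e b = inc f b -> e = f.

Definition hgraph_triangle_free (S : hgraph) := forall (e f g : hedge S) a b c,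
  a != b -> b != c -> a != c ->
  inc e a = inc f a -> inc f b = inc g b -> inc g c = inc e c ->
  e = f /\ f = g.

(** Each edge is a copy of [P], with the element [u] of [P] sitting on the vertex
of [e] at position [pos u]; [r] ranks all these elements. *)
Definition profile (S : hgraph) (r : point S -> P -> nat) (e : hedge S) :
    {set P * P} :=
  [set q | r (inc e (pos q.1)) q.1 <= r (inc e (pos q.2)) q.2].

(** The freedom to impose the guess off [Q] in advance is what an induction on [Q]
consumes. *)
Definition forces (S : hgraph) (Q : {set P * P}) :=
  forall (r : point S -> P -> nat) (m : {set P * P}) (d : D),
    exists e : hedge S, (lab e).2 = d /\
      forall q, (q \in (lab e).1) = (if q \in Q then q \in profile r e else q \in m).

Definition free_hgraph : hgraph :=
  @HGraph ({set P * P} * D)%type ({set P * P} * D)%type (fun l _ => l) id.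

(** Disjoint copies of [S], indexed by [J], where only the vertices at position
[j] are identified, with points of [Y]. *)
Definition glue (S : hgraph) (j : I) (Y J : finType) (phi : J -> point S -> Y) :
    hgraph :=
  @HGraph (Y + J * point S)%type (J * hedge S)%type
    (fun pe i => if i == j then inl (phi pe.1 (inc pe.2 j))
                 else inr (pe.1, inc pe.2 i))
    (fun pe => lab pe.2).

Section Glue.
Variables (S : hgraph) (j : I) (Y J : finType) (phi : J -> point S -> Y).
Hypothesis phi_inj : forall p, injective (phi p).

Lemma glue_inc (pe pf : hedge (glue j phi)) a :
  a != j -> inc pe a = inc pf a -> pe.1 = pf.1.
Proof. by move=> /negbTE /= ->; case. Qed.

Lemma glue_incK p (e f : hedge S) a :
  inc (h := glue j phi) (p, e) a = inc (h := glue j phi) (p, f) a ->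
  inc e a = inc f a.
Proof. by rewrite /=; case: eqP => [->|_] [] // /phi_inj. Qed.

(** Edges of two different copies can only meet at position [j], and each edge has
a single vertex there. *)
Lemma glue_linear : linear_hgraph S -> linear_hgraph (glue j phi).
Proof.
move=> lin [p e] [q f] a b ab ea eb.
have epq : p = q.
  have [aj|aj] := eqVneq a j; last exact: (glue_inc aj ea).
  by apply: (glue_inc _ eb); rewrite -aj eq_sym.
rewrite -epq in ea eb *; congr (_, _).
exact: lin ab (glue_incK ea) (glue_incK eb).
Qed.

(** Of the three positions where the edges meet at least two differ from [j], so
the three edges are in the same copy. *)
Lemma glue_triangle_free :
  hgraph_triangle_free S -> hgraph_triangle_free (glue j phi).
Proof.
move=> tf [p e] [q f] [s g] a b c ab bc ac ea eb ec.
have [epq eqs] : p = q /\ q = s.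
  have [aj|aj] := eqVneq a j.
    have bj : b != j by rewrite -aj eq_sym.
    have cj : c != j by rewrite -aj eq_sym.
    by have /= -> := glue_inc bj eb; have /= -> := glue_inc cj ec.
  have /= pq := glue_inc aj ea.
  have [bj|bj] := eqVneq b j; last by have /= qs := glue_inc bj eb; split.
  have cj : c != j by rewrite -bj eq_sym.
  by have /= sp := glue_inc cj ec; split; rewrite // sp.
rewrite -eqs -epq in ea eb ec *.
by have [-> ->] := tf _ _ _ _ _ _ ab bc ac (glue_incK ea) (glue_incK eb) (glue_incK ec).
Qed.

Definition piece_rank (r : point (glue j phi) -> P -> nat) p x u :=
  r (if pos u == j then inl (phi p x) else inr (p, x)) u.

Lemma profile_glue (r : point (glue j phi) -> P -> nat) p e :
  profile r ((p, e) : hedge (glue j phi)) = profile (piece_rank r p) e.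
Proof.
apply/setP=> -[u v]; rewrite !inE /= /piece_rank.
by case: (pos u =P j) => [->|_]; case: (pos v =P j) => [->|_].
Qed.

Lemma forces_glue Q (r : point (glue j phi) -> P -> nat) p (m : {set P * P}) d :
  forces S Q ->
  exists e : hedge S, (lab e).2 = d /\
    forall q, (q \in (lab e).1) =
      (if q \in Q then q \in profile r ((p, e) : hedge (glue j phi)) else q \in m).
Proof.
move=> fS; have [e [ed eQ]] := fS (piece_rank r p) m d.
by exists e; split=> // q; rewrite profile_glue.
Qed.
End Glue.

(** The points at position [j] form the square of [point S].  One copy of [S] is
put on each row, and one on the graph of each function. *)
Section Diagonal.
Variables (S : hgraph) (j : I).

Definition diag_map (k : point S + {ffun point S -> point S}) (x : point S) :=
  match k with inl k => (k, x) | inr f => (x, f x) end.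

Lemma diag_map_inj k : injective (diag_map k).
Proof. by case: k => [k|f] x y []. Qed.

Definition diag := glue j diag_map.
End Diagonal.

(** Let the copies on the rows guess [u <= v].  Either the guess is right on some
row, or it is refuted by an edge [E k] on each row [k].  Then the points where
these edges meet their rows form the graph of a function.  The copy on this graph
is told to guess [v < u], and each of its edges shares its vertex at position
[pos v] with an edge refuting [u <= v]. *)
Lemma forces_diag S Q u v (r : point (diag S (pos v)) -> P -> nat) (m : {set P * P}) d :
  forces S Q ->
  (exists e : hedge (diag S (pos v)), (lab e).2 = d /\
      forall q, (q \in (lab e).1) =
        (if q \in (u, v) |: Q then q \in profile r e else q \in m)) \/
  exists (E : point S -> hedge S) (e : hedge S),
   [/\ forall k, (u, v) \notin profile r ((inl k, E k) : hedge (diag S (pos v))),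
      (lab e).2 = d,
      forall q, (q \in (lab e).1) =
        (if q \in Q then q \in profile r ((inr [ffun k => inc (E k) (pos v)], e) : hedge (diag S (pos v)))
         else q \in m :\ (u, v))
    & (u, v) \notin Q].
Proof.
move=> fS; have [uvQ|uvQ] := boolP ((u, v) \in Q).
  (* The pair is already controlled, so any copy of [S] will do. *)
  left; have [k _|X0] := pickP [pred x : point S | true].
    have [e [ed eQ]] := forces_glue (phi := @diag_map S) r (inl k) m d fS.
    by exists (inl k, e); split=> // q; rewrite (setUidPr _) ?sub1set.
  have [e _] := fS (fun _ _ => 0) m d.
  by have := X0 (inc e (pos v)).
have [[k [e [ed eQ uvr]]]|no] := pselect (exists k e, [/\ (lab e).2 = d,
   forall q, (q \in (lab e).1) = (if q \in Q then q \in profile r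
      ((inl k, e) : hedge (diag S (pos v))) else q \in (u, v) |: m) &
   (u, v) \in profile r ((inl k, e) : hedge (diag S (pos v)))]).
  left; exists (inl k, e); split=> // q.
  rewrite [lab _]/= eQ !in_setU1.
  by have [->|] /= := eqVneq q (u, v); rewrite // (negbTE uvQ) uvr.
have {}no k : exists e, (u, v) \notin profile r ((inl k, e) : hedge (diag S (pos v))).
  have [e [ed eQ]] := forces_glue (phi := @diag_map S) r (inl k) ((u, v) |: m) d fS.
  by exists e; apply/negP => uvr; apply: no; exists k, e.
have [E HE] := choice no.
right; exists E.
have [e [ed eQ]] := forces_glue (phi := @diag_map S) r
  (inr [ffun k => inc (E k) (pos v)]) (m :\ (u, v)) d fS.
by exists e.
Qed.

(** When [u] and [v] sit on the same vertex, the truth of [u <= v] depends on this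
vertex only, so a shared vertex passes the refutation on. *)
Lemma forces_diag_same S Q u v : pos u = pos v -> forces S Q ->
  forces (diag S (pos v)) ((u, v) |: Q).
Proof.
move=> uv fS r m d.
have [//|[E [e [HE ed eQ uvQ]]]] := forces_diag u r m d fS.
exists (inr [ffun k => inc (E k) (pos v)], e); split=> // q.
rewrite [lab _]/= eQ !in_setU1 in_setD1.
have [->|] //= := eqVneq q (u, v).
rewrite (negbTE uvQ); symmetry; apply: negbTE.
have := HE (inc e (pos v)).
by rewrite !inE /= uv eqxx /= ffunE.
Qed.

(** A permutation [s] minimizing the sum of [rk (s x)] over [L] works: exchanging
the values at a bad pair would decrease the sum. *)
Lemma exists_sorting_perm (X : finType) (L : {set X}) (rk : X -> nat) :
  exists s : {perm X}, forall x y, x \in L -> y \notin L -> rk (s x) <= rk (s y).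
Proof.
pose w (s : {perm X}) := \sum_(x in L) rk (s x).
have [s _ smin] := arg_minnP w (erefl : xpredT (1%g : {perm X})).
exists s => x y xL yL; rewrite leqNgt; apply/negP => lt.
have := smin (tperm x y * s)%g isT; rewrite leqNgt => /negP; apply.
rewrite /w (bigD1 x) //= [ltnRHS](bigD1 x) //= permM tpermL -addSn leq_add //.
apply: leq_sum => z /andP[zL zx]; rewrite permM tpermD 1?eq_sym //.
by apply: contraNneq yL => <-.
Qed.

(** At position [i] the diagonal gluing is identified with itself in all possible
ways, so that for any ranking some copy is arranged as one likes there. *)
Definition order_step S i j :=
  glue i (fun s : {perm point (diag S j)} => (s : point (diag S j) -> _)).

(** Choose the copy of the diagonal gluing where the elements [u] on the row
copies are below those on the other copies.  If all rows refute [u <= v], then [v]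
on a shared vertex is below [u] on some row, hence below [u] on each edge of the
copy on the graph, where the guess [v < u] is right. *)
Lemma forces_order_step S Q u v : pos u != pos v -> forces S Q ->
  forces (order_step S (pos u) (pos v)) ((u, v) |: Q).
Proof.
move=> uv fS r m d; set T := diag S (pos v).
pose low : {set point T} := [set x | if x is inr (inl _, _) then true else false].
have [s Hs] := exists_sorting_perm low (fun x => r (inl x) u).
pose phi := (fun s : {perm point T} => (s : point T -> point T)).
pose r' := piece_rank (phi := phi) (j := pos u) r s.
have [[e [ed eQ]]|[E [e [HE ed eQ uvQ]]]] := forces_diag u r' m d fS.
  by exists (s, e); split=> // q; rewrite profile_glue; exact: eQ.
pose e' : hedge T := (inr [ffun k => inc (E k) (pos v)], e).
exists (s, e'); split=> // q; rewrite profile_glue [lab _]/= eQ !in_setU1 in_setD1.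
have [->|] //= := eqVneq q (u, v).
rewrite (negbTE uvQ); symmetry; apply: negbTE.
have := HE (inc e (pos v)); rewrite !inE /= !eqxx (negbTE uv) /= ffunE -!ltnNge.
move=> lt; apply: leq_trans lt _; rewrite /r' /piece_rank eqxx /phi.
by apply: Hs; rewrite inE.
Qed.

Theorem exists_forcing_hgraph :
  exists S, [/\ linear_hgraph S, hgraph_triangle_free S & forces S setT].
Proof.
suff H (s : seq (P * P)) : exists S, [/\ linear_hgraph S, hgraph_triangle_free S
    & forces S [set q in s]].
  have [S [lS tS fS]] := H (enum [set: P * P]); exists S; split=> //.
  by have -> : setT = [set q in enum [set: P * P]] by apply/setP=> q; rewrite !inE mem_enum inE.
elim: s => [|[u v] s [S [lS tS fS]]].
  exists free_hgraph; split.
  - by move=> e f a b _.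
  - by move=> e f g a b c _ _ _.
  - by move=> r m d; exists (m, d); split=> // q; rewrite in_set in_nil.
rewrite set_cons.
have [uv|uv] := eqVneq (pos u) (pos v).
  exists (diag S (pos v)); split; last exact: forces_diag_same.
  - exact: (glue_linear (@diag_map_inj S)).
  - exact: (glue_triangle_free (@diag_map_inj S)).
exists (order_step S (pos u) (pos v)); split; last exact: forces_order_step.
- by apply: glue_linear (glue_linear (@diag_map_inj S) lS) => p; apply: perm_inj.
- by apply: glue_triangle_free (glue_triangle_free (@diag_map_inj S) tS) => p; apply: perm_inj.
Qed.

End Hypergraphs.

(** * Triangles and centres of bowtie-free graphs *)
Definition triangle (V : Type) (G : sgraph V) (x y z : V) : Prop :=
  [/\ G x y, G x z & G y z].

(** Two non-adjacent apexes are enough to witness an induced chimney. *)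
Definition spine (V : Type) (G : sgraph V) (l r : V) : Prop :=
  exists y z, [/\ triangle G l r y, triangle G l r z, y <> z & ~~ G y z].

Section General.
Variables (V : Type) (G : sgraph V).

Lemma adj_neq x y : G x y -> x <> y.
Proof. by move=> xy e; rewrite e adj_irr in xy. Qed.

Lemma triangle_swap x y z : triangle G x y z -> triangle G x z y.
Proof. by case=> xy xz yz; split; rewrite // adj_sym. Qed.

Lemma triangle_rot x y z : triangle G x y z -> triangle G y z x.
Proof. by case=> xy xz yz; split; rewrite // adj_sym. Qed.

Lemma spine_sym l r : spine G l r -> spine G r l.
Proof.
case=> y [z [ty tz yz nyz]]; exists y, z; split=> //;
  by apply/triangle_swap/triangle_rot.
Qed.

Lemma bowtie_freeP :
  (forall v a b c d, triangle G v a b -> triangle G v c d ->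
     [\/ a = c, a = d, b = c | b = d]) -> bowtie_free G.
Proof.
move=> H [f [fI fG]].
have ne x y : x <> y -> f x <> f y by move=> xy /fI.
have T i : triangle G (f None) (f (Some (i, false))) (f (Some (i, true))).
  by split; apply: fG => //=; rewrite eqxx.
by case: (H _ _ _ _ _ (T false) (T true)) => /fI.
Qed.

Lemma bowtie_free_triangles v a b c d : bowtie_free G ->
  triangle G v a b -> triangle G v c d -> [\/ a = c, a = d, b = c | b = d].
Proof.
move=> bf [va vb ab] [vc vd cd].
have [ac|ac] := pselect (a = c); first by constructor 1.
have [ad|ad] := pselect (a = d); first by constructor 2.
have [bc|bc] := pselect (b = c); first by constructor 3.
have [bd|bd] := pselect (b = d); first by constructor 4.
case: bf; exists (fun x => match x with
  | None => v | Some (false, false) => a | Some (false, true) => b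
  | Some (true, false) => c | Some (true, true) => d end).
have := (adj_neq va, adj_neq vb, adj_neq ab, adj_neq vc, adj_neq vd, adj_neq cd).
move=> [[[[[? ?] ?] ?] ?] ?].
split.
  by move=> [[[] []]|] [[[] []]|] //= e; case: notF; exfalso; congruence.
by move=> [[[] []]|] [[[] []]|] //= _; rewrite // adj_sym.
Qed.

Lemma two_apex_chimney l r y z :
  triangle G l r y -> triangle G l r z -> y <> z -> ~~ G y z ->
  exists f : 'I_2 + bool -> V, [/\ induced_copy (chimney 2) G f,
    f (inr false) = l, f (inr true) = r, f (inl ord0) = y & f (inl ord_max) = z].
Proof.
move=> [lr ly ry] [_ lz rz] yz nyz.
pose f (x : 'I_2 + bool) := match x with
  | inr false => l | inr true => r | inl i => if i == ord0 then y else z end.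
have := (adj_neq lr, adj_neq ly, adj_neq ry, adj_neq lz, adj_neq rz).
move=> [[[[? ?] ?] ?] ?].
exists f; split=> //; split.
  move=> [i|[]] [j|[]] //=; rewrite /f; try (by move=> e; exfalso; congruence);
  try (by case: ifP => _ e; exfalso; congruence).
  case: (eqVneq i ord0) => [->|i0]; case: (eqVneq j ord0) => [->|j0] // e;
    try (by exfalso; congruence).
  congr inl; apply: val_inj => /=; case: i j i0 j0 {e} => [[|[|i]] Hi] [[|[|j]] Hj] //.
have e : (G y z = false) by apply: negbTE.
move=> [i|[]] [j|[]] //=; rewrite ?(adj_irr G) //; try by case: ifP.
- by case: ifP; case: ifP; rewrite ?(adj_irr G) // (adj_sym G) e.
- by case: ifP => _; rewrite (adj_sym G).
- by case: ifP => _; rewrite (adj_sym G).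
- by rewrite (adj_sym G).
Qed.

Lemma chimney_centreP l r : chimney_centre G l r <-> spine G l r.
Proof.
split.
  case=> n [f [n1 [fI fG] <- <-]].
  have F x y : chimney_adj x y -> G (f x) (f y) by rewrite fG.
  exists (f (inl (Ordinal (ltnW n1)))), (f (inl (Ordinal n1))).
  split; try (by split; apply: F); last by rewrite fG.
  by move/fI.
case=> y [z [ty tz yz nyz]].
by have [f [fG fl fr _ _]] := two_apex_chimney ty tz yz nyz; exists 2, f.
Qed.

Definition K4_on a b c d :=
  [/\ triangle G a b c, triangle G a b d, triangle G a c d & triangle G b c d].

Lemma K4_on_rot v a b c : K4_on v a b c -> K4_on a b c v.
Proof.
by case=> -[va vb ab] [_ vc ac] [_ _ bc] _; split; split; rewrite // adj_sym.
Qed.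

Lemma K4_copy f : copy K4 G f -> forall i j, i != j -> G (f i) (f j).
Proof. by case=> _ H i j ij; apply: H. Qed.

Lemma in_K4P v : in_K4 G v <-> exists a b c, K4_on v a b c.
Proof.
split.
  case=> f [/K4_copy fG [i <-]].
  pose o k : 'I_4 := inord ((i + k) %% 4).
  have oE k : val (o k) = (i + k) %% 4 by rewrite /o /= inordK ?ltn_mod.
  have o0 : o 0 = i by apply: val_inj; rewrite oE addn0 modn_small.
  have ne j k : j < 4 -> k < 4 -> j != k -> G (f (o j)) (f (o k)).
    move=> j4 k4 jk; apply: fG; rewrite -val_eqE !oE eqn_modDl !modn_small //.
  exists (f (o 1)), (f (o 2)), (f (o 3)); rewrite -o0.
  by split; split; apply: ne.
case=> a [b [c [[va vb ab] [_ vc ac] [_ _ bc] _]]].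
pose f (x : 'I_4) := nth v [:: v; a; b; c] x.
have := (adj_neq va, adj_neq vb, adj_neq ab, adj_neq vc, adj_neq ac, adj_neq bc).
move=> [[[[[? ?] ?] ?] ?] ?].
exists f; split; last by exists ord0.
split.
  by move=> [[|[|[|[|i]]]] Hi] [[|[|[|[|j]]]] Hj] //=; rewrite /f /= => e;
    try (by exfalso; congruence); apply: val_inj.
by move=> [[|[|[|[|i]]]] Hi] [[|[|[|[|j]]]] Hj] //= _; rewrite /f //= adj_sym.
Qed.

Lemma in_chimney_spine v : in_chimney G v ->
  exists l r, spine G l r /\ [\/ v = l, v = r | triangle G l r v].
Proof.
case=> n [f [n1 fG [x <-]]]; exists (f (inr false)), (f (inr true)).
split; first by apply/chimney_centreP; exists n, f.
have F y z : chimney_adj y z -> G (f y) (f z) by case: fG => _ ->.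
case: x => [i|[]]; [constructor 3 | by constructor 2 | by constructor 1].
by split; apply: F.
Qed.

(** Four vertices inducing a K_4 or the smallest chimney: the least amount of
vertices that makes each of them satisfy the condition in [good]. *)
Variant seed (a b c d : V) : Prop :=
  | SeedK4 of K4_on a b c d
  | SeedChimney of triangle G a b c & triangle G a b d & c <> d & ~~ G c d.

Lemma seed_good a b c d x : seed a b c d ->
  [\/ x = a, x = b, x = c | x = d] -> in_chimney G x \/ in_K4 G x.
Proof.
case=> [k H|tc td cd ncd H].
  right; apply/in_K4P; have ka := K4_on_rot k; have kb := K4_on_rot ka.
  have kc := K4_on_rot kb.
  by case: H => ->; [exists b, c, d | exists c, d, a | exists d, a, b | exists a, b, c].
left; have [f [fG fa fb fc fd]] := two_apex_chimney tc td cd ncd.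
by exists 2, f; split=> //; case: H => ->; eexists; eassumption.
Qed.

End General.

Section Local.
Variables (V : finType) (G : sgraph V).
Hypothesis bf : bowtie_free G.

Lemma edge0P x y : reflect (exists z, triangle G x y z) (edge0 G x y).
Proof.
apply: (iffP andP) => [[xy /existsP[z /andP[xz yz]]]|[z [xy xz yz]]].
  by exists z.
by split=> //; apply/existsP; exists z; rewrite xz.
Qed.

Lemma edge0_sym : symmetric (edge0 G).
Proof.
by move=> x y; apply/edge0P/edge0P => -[z [xy xz yz]]; exists z; split; rewrite // adj_sym.
Qed.

(** The next three lemmas compute the neighbours in (V, E_0) in each of the three
possible situations.  A triangle at [v] has to meet all three triangles that [v]
has in the K_4, so it lies in the K_4. *)
Lemma edge0_K4 v a b c w : K4_on G v a b c ->
  edge0 G v w = (w \in [:: a; b; c]).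
Proof.
move=> [t1 t2 t3 _]; apply/edge0P/idP => [[z t]|].
  have [_ _ Gwz] := t; have wz := adj_neq Gwz.
  have [[_ _ Gab] [_ _ Gac] [_ _ Gbc]] := And3 t1 t2 t3.
  have := (adj_neq Gab, adj_neq Gac, adj_neq Gbc) => -[[ab ac] bc].
  have := bowtie_free_triangles bf t t1.
  have := bowtie_free_triangles bf t t2.
  have := bowtie_free_triangles bf t t3.
  rewrite !inE.
  have [->|wa] := eqVneq w a; first by [].
  have [->|wb] := eqVneq w b; first by [].
  have [->|wc] := eqVneq w c; first by [].
  move=> /eqP in wa; move/eqP in wb; move/eqP in wc.
  by do 3![case=> ?]; exfalso; congruence.
rewrite !inE => /or3P[] /eqP ->.
- by exists b.
- by exists a; apply: triangle_swap.
- by exists a; apply: triangle_swap.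
Qed.

(** A triangle at [l] that avoids [r] has to meet the triangles [l r y] and
[l r z] in [y] and in [z], which are not adjacent. *)
Lemma edge0_spine l r w : spine G l r ->
  edge0 G l w <-> w = r \/ triangle G l r w.
Proof.
move=> [y [z [ty tz yz nyz]]]; split; last first.
  case=> [->|t]; apply/edge0P; first by exists y.
  by exists r; apply: triangle_swap.
case/edge0P=> t T; have [_ lt wt] := T.
have [->|/eqP wr] := eqVneq w r; first by left.
have [tr|/eqP tr] := eqVneq t r.
  by right; apply: triangle_swap; rewrite -tr.
have E1 := bowtie_free_triangles bf T ty; have E2 := bowtie_free_triangles bf T tz.
exfalso; move/negP: nyz; apply.
case: E1 => // e1; case: E2 => // e2; try (by exfalso; congruence); rewrite -e1 -e2 //.
by rewrite adj_sym.
Qed.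

(** A triangle at [v] contains [l] or [r], say [l]; then [edge0_spine] applies to
its third vertex, and a second apex adjacent to [v] is excluded as before. *)
Lemma edge0_apex l r v w : spine G l r -> triangle G l r v ->
  edge0 G v w <-> w = l \/ w = r.
Proof.
move=> sp T; have T' : triangle G v l r by apply/triangle_rot/triangle_rot.
split; last first.
  case=> ->; apply/edge0P; first by exists r.
  by exists l; apply: triangle_swap.
case/edge0P => t Tw.
have [->|/eqP wl] := eqVneq w l; first by left.
have [->|/eqP wr] := eqVneq w r; first by right.
wlog tl : l r sp T T' wl wr / t = l.
  move=> H; have [|/eqP tl] := eqVneq t l; first exact: H.
  case: (bowtie_free_triangles bf Tw T') => // tr.
  have T2 := triangle_swap T'.
  by have := H r l (spine_sym sp) (triangle_rot T2) T2 wr wl tr; tauto.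
rewrite {t}tl in Tw.
have lw : edge0 G l w by apply/edge0P; exists v; apply: triangle_swap; do 2!apply: triangle_rot.
have vw : G v w by case: Tw.
have [//|Tlw] := (edge0_spine _ sp).1 lw.
have [y [z [ty tz yz nyz]]] := sp.
have Tl : triangle G l v w by apply: triangle_rot; apply: triangle_rot.
have E1 := bowtie_free_triangles bf Tl ty; have E2 := bowtie_free_triangles bf Tl tz.
have [_ _ Grv] := T; have nrv := adj_neq Grv.
exfalso; move/negP: nyz; apply.
case: E1 => e1; case: E2 => e2; try (by exfalso; congruence); rewrite -e1 -e2 //.
by rewrite adj_sym.
Qed.

End Local.

Section Centres.
Variables (V : finType) (G : sgraph V).
Hypothesis bf : bowtie_free G.

Lemma triangles_containing v a b : triangle G v a b ->
  [set v; a; b] \in [set T in triangles G | v \in T].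
Proof.
move=> [va vb ab].
have [[/eqP nva /eqP nvb] /eqP nab] := (adj_neq va, adj_neq vb, adj_neq ab).
rewrite !inE eqxx /= andbT; apply/andP; split.
  by rewrite -setUA cardsU1 cards2 !inE negb_or nva nvb nab.
apply/forall_inP=> x; rewrite !inE => /orP[/orP[]|] /eqP ->;
  apply/forall_inP=> y; rewrite !inE => /orP[/orP[]|] /eqP ->;
  rewrite ?eqxx ?va ?vb ?ab ?implybT // adj_sym ?va ?vb ?ab ?implybT //.
Qed.

Lemma central_two_triangles v a b c :
  triangle G v a b -> triangle G v a c -> b <> c -> central G v.
Proof.
move=> tb tc bc.
apply: leq_trans (subset_leq_card (_ : [set [set v; a; b]; [set v; a; c]] \subset _));
  last by apply/subsetP=> T; rewrite in_set2 => /orP[] /eqP ->; exact: triangles_containing.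
rewrite cards2; case: eqP => // /setP /(_ b).
have [_ vb ab] := tb; have nvb := adj_neq vb; have nab := adj_neq ab.
rewrite !inE eqxx orbT; case: eqP => [?|_]; first by exfalso; congruence.
by case: eqP => [?|_]; [exfalso; congruence | case: eqP].
Qed.

Lemma central_K4 v a b c : K4_on G v a b c -> central G v.
Proof.
move=> [t1 t2 _ [_ _ bc]].
exact: central_two_triangles t1 t2 (adj_neq bc).
Qed.

Lemma central_spine l r : spine G l r -> central G l.
Proof. by move=> [y [z [ty tz yz _]]]; exact: central_two_triangles ty tz yz. Qed.

Lemma not_central_apex l r v : spine G l r -> triangle G l r v -> ~~ central G v.
Proof.
move=> sp t; rewrite -leqNgt -(cards1 [set v; l; r]).
apply/subset_leq_card/subsetP=> T; rewrite inE => /andP[TT vT]; rewrite inE.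
move: TT; rewrite inE => /andP[/eqP T3 /forall_inP HT].
have adjT x y : x \in T -> y \in T -> x != y -> G x y.
  by move=> xT yT; apply/implyP; move/forall_inP: (HT x xT); apply.
rewrite eqEcard T3 -setUA (leq_trans (leq_card_setU _ _)) ?andbT; last first.
  by rewrite cards1 cards2; case: (_ != _).
apply/subsetP=> w wT; rewrite !inE; have [//|wv] := eqVneq w v.
have /card_gt0P [x] : 0 < #|T :\ v :\ w|.
  by move: T3; rewrite (cardsD1 v T) vT (cardsD1 w) !inE wv wT /= !add1n => -[->].
rewrite !inE => /and3P[xw xv xT].
have vw : edge0 G v w.
  by apply/edge0P; exists x; split; apply: adjT; rewrite // eq_sym.
by have [->|->] := (edge0_apex bf _ sp t).1 vw; rewrite eqxx ?orbT.
Qed.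

Lemma edge0_connect_sym : connect_sym (edge0 G).
Proof. exact: sym_connect_sym (edge0_sym G). Qed.

Lemma connect_centre u v : connect (edge0 G) u v -> centre G u = centre G v.
Proof.
move=> uv; apply/setP=> w; rewrite !inE; congr (_ && _).
exact: (same_connect edge0_connect_sym uv).
Qed.

Lemma connect_closed_sub (S : {set V}) v :
  (forall x y, x \in S -> edge0 G x y -> y \in S) -> v \in S ->
  forall u, connect (edge0 G) v u -> u \in S.
Proof.
move=> clS vS u /connectP[p]; elim: p v vS => [|w p IH] v vS /= => [_ -> //|].
by case/andP=> vw; apply: IH; apply: clS vw.
Qed.

Lemma centre_K4 v a b c : K4_on G v a b c -> centre G v = [set v; a; b; c].
Proof.
move=> k; have ka := K4_on_rot k; have kb := K4_on_rot ka; have kc := K4_on_rot kb.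
apply/setP=> u; rewrite inE; apply/andP/idP=> [[_]|].
  apply: connect_closed_sub; last by rewrite !inE eqxx.
  move=> x y; rewrite !inE => /orP[/orP[/orP[]|]|] /eqP ->;
    rewrite ?(edge0_K4 bf _ k) ?(edge0_K4 bf _ ka) ?(edge0_K4 bf _ kb) ?(edge0_K4 bf _ kc) !inE;
    by case/or3P=> ->; rewrite ?orbT.
have E w : w \in [:: a; b; c] -> connect (edge0 G) v w.
  by rewrite -(edge0_K4 bf _ k) => /connect1.
rewrite !inE => /orP[/orP[/orP[]|]|] /eqP ->; split;
  try (by [exact: central_K4 k | exact: central_K4 ka | exact: central_K4 kb
          | exact: central_K4 kc]);
  rewrite ?connect0 //; apply: E; rewrite !inE eqxx ?orbT //.
Qed.

Lemma centre_spine l r : spine G l r -> centre G l = [set l; r].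
Proof.
move=> sp; have sp' := spine_sym sp.
pose S := [set w | [|| w == l, w == r | edge0 G l w]].
have SE w : edge0 G l w -> w \in S by rewrite inE => ->; rewrite !orbT.
apply/setP=> u; rewrite inE; apply/andP/idP=> [[cu]|].
  move=> lu; have : u \in S.
    apply: connect_closed_sub lu; last by rewrite inE eqxx.
    move=> x y; rewrite [in X in X -> _]inE => /or3P[/eqP ->|/eqP ->|].
    - exact: SE.
    - move=> /(edge0_spine bf _ sp') [->|t]; first by rewrite inE eqxx.
      apply/SE/edge0P; exists r; exact: triangle_rot.
    move/(edge0_spine bf _ sp) => [->|t].
      move=> /(edge0_spine bf _ sp') [->|t]; first by rewrite inE eqxx.
      apply/SE/edge0P; exists r; exact: triangle_rot.
    by move=> /(edge0_apex bf _ sp t) [] ->; rewrite inE eqxx ?orbT.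
  rewrite !inE => /or3P[->//|->|]; first by rewrite orbT.
  move/(edge0_spine bf _ sp) => [->|t]; first by rewrite eqxx orbT.
  by have := not_central_apex sp t; rewrite cu.
rewrite !inE => /orP[] /eqP ->; split; rewrite ?connect0 //.
- exact: central_spine sp.
- exact: central_spine sp'.
- by apply: connect1; apply/(edge0_spine bf _ sp); left.
Qed.

Lemma centre_apex l r v : spine G l r -> triangle G l r v ->
  centre G v = [set l; r].
Proof.
move=> sp t; rewrite -(centre_spine sp); apply: connect_centre.
by apply: connect1; apply/(edge0_apex bf _ sp t); left.
Qed.

Lemma card_centre_K4 v a b c : K4_on G v a b c -> #|centre G v| = 4.
Proof.
move=> k; rewrite (centre_K4 k).
case: k => -[va vb ab] [_ vc ac] [_ _ bc] _.
have := (adj_neq va, adj_neq vb, adj_neq vc, adj_neq ab, adj_neq ac, adj_neq bc).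
move=> [[[[[/eqP/negbTE nva /eqP/negbTE nvb] /eqP/negbTE nvc] /eqP/negbTE nab]
  /eqP/negbTE nac] /eqP/negbTE nbc].
have -> : [set v; a; b; c] = v |: (a |: [set b; c]) by rewrite -!setUA.
by rewrite !cardsU1 cards1 !inE nva nvb nvc nab nac nbc.
Qed.

End Centres.

(** * Good graphs *)

(** What the position of a vertex of a good graph can be. *)
Variant kind (V : Type) (G : sgraph V) (v : V) : Prop :=
  | KindK4 a b c of K4_on G v a b c
  | KindEnd r of spine G v r
  | KindApex l r of spine G l r & triangle G l r v.

Lemma good_kind (V : Type) (G : sgraph V) v : good G -> kind G v.
Proof.
case=> _ gG; have [ch|k4] := gG v; last first.
  by have [a [b [c k]]] := (in_K4P G v).1 k4; exact: KindK4 k.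
have [l [r [sp [->|->|t]]]] := in_chimney_spine ch.
- exact: KindEnd sp.
- exact: KindEnd (spine_sym sp).
- exact: KindApex sp t.
Qed.

(** In the apex case [v] may be different from the two witnesses of the spine; then
it is not adjacent to either of them and replaces one of them. *)
Lemma good_seed (V : Type) (G : sgraph V) v : good G ->
  exists a b c d, seed G a b c d /\ [\/ v = a, v = b, v = c | v = d].
Proof.
move=> gG; have bf := proj1 gG.
case: (good_kind v gG) => [a b c k|r [y [z [ty tz yz nyz]]]|l r [y [z [ty tz yz nyz]]] t].
- by exists v, a, b, c; split; [exact: SeedK4 | constructor 1].
- by exists v, r, y, z; split; [exact: SeedChimney | constructor 1].
have [vz|vz] := pselect (v = z).
  by exists l, r, y, z; split; [exact: SeedChimney | constructor 4].
have [vy|vy] := pselect (v = y).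
  by exists l, r, y, z; split; [exact: SeedChimney | constructor 3].
exists l, r, v, y; split; last by constructor 3.
apply: SeedChimney => //; apply/negP=> Gvy.
have [_ lv rv] := t; have [_ ly ry] := ty.
have tv : triangle G l v y by split.
have nrv := adj_neq rv; have nry := adj_neq ry.
by case: (bowtie_free_triangles bf tv tz) => ?; congruence.
Qed.

Section Good.
Variables (V : finType) (G : sgraph V).
Hypothesis gG : good G.
Let bf : bowtie_free G := proj1 gG.

Lemma card_centre_spine l r : spine G l r -> #|centre G l| = 2.
Proof.
move=> sp; rewrite (centre_spine bf sp) cards2.
by have [y [z [[lr _ _] _ _ _]]] := sp; have /eqP -> := adj_neq lr.
Qed.

Lemma card_centre_apex l r v : spine G l r -> triangle G l r v -> #|centre G v| = 2.
Proof.
by move=> sp t; rewrite (centre_apex bf sp t) -(centre_spine bf sp) (card_centre_spine sp).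
Qed.

Lemma card_centreP v : #|centre G v| = 2 \/ #|centre G v| = 4.
Proof.
case: (good_kind v gG) => [a b c k|r sp|l r sp t].
- by right; exact: card_centre_K4 k.
- by left; exact: card_centre_spine sp.
- by left; exact: card_centre_apex sp t.
Qed.

Lemma central_card4 v : #|centre G v| = 4 -> central G v.
Proof.
case: (good_kind v gG) => [a b c k|r sp|l r sp t].
- by rewrite (central_K4 k).
- by rewrite (central_spine sp).
- by rewrite (card_centre_apex sp t).
Qed.

Lemma in_K4_centre v : in_K4 G v <-> #|centre G v| = 4.
Proof.
rewrite in_K4P; split=> [[a [b [c k]]]|]; first exact: card_centre_K4 k.
case: (good_kind v gG) => [a b c k _|r sp|l r sp t].
- by exists a, b, c.
- by rewrite (card_centre_spine sp).
- by rewrite (card_centre_apex sp t).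
Qed.

Lemma chimney_end v : central G v -> #|centre G v| = 2 -> exists r, spine G v r.
Proof.
case: (good_kind v gG) => [a b c k|r sp|l r sp t].
- by rewrite (card_centre_K4 bf k).
- by exists r.
- by rewrite (negbTE (not_central_apex bf sp t)).
Qed.

Lemma mem_centre v : central G v -> v \in centre G v.
Proof. by rewrite inE connect0 andbT. Qed.

Lemma centre_of_mem u v : u \in centre G v -> centre G u = centre G v.
Proof. by rewrite inE => /andP[_ /(connect_centre (G := G))]. Qed.

(** The relation E_0 is determined by the centres and the central vertices, which
is how it is compared between graphs. *)
Lemma edge0E u v :
  edge0 G u v = [&& u != v, centre G u == centre G v & central G u || central G v].
Proof.
apply/idP/and3P => [e|[uv /eqP cuv]].
  split.
  - by have /edge0P[x [uv _ _]] := e; apply/eqP; exact: adj_neq uv.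
  - by apply/eqP/connect_centre/connect1.
  - case: (good_kind u gG) => [a b c k|r sp|l r sp t].
    + by rewrite (central_K4 k).
    + by rewrite (central_spine sp).
    + case/(edge0_apex bf _ sp t): e => ->; first by rewrite (central_spine sp) orbT.
      by rewrite (central_spine (spine_sym sp)) orbT.
wlog cv : u v uv cuv / central G v.
  move=> H; case/orP=> [cu|cv]; last by rewrite H ?cv ?orbT.
  by rewrite edge0_sym H ?cu ?orbT // eq_sym.
move=> _; have := mem_centre cv; rewrite -cuv.
case: (good_kind u gG) => [a b c k|r sp|l r sp t].
- by rewrite (centre_K4 bf k) (edge0_K4 bf _ k) !inE (eq_sym v u) (negbTE uv) orbA.
- rewrite (centre_spine bf sp) !inE eq_sym (negbTE uv) => /eqP ->.
  by apply/(edge0_spine bf _ sp); left.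
- rewrite (centre_apex bf sp t) !inE => /orP[] /eqP ->;
  by apply/(edge0_apex bf _ sp t); auto.
Qed.

(** Two adjacent vertices with the same centre are never both apexes of a chimney:
together with an end they would form a triangle. *)
Lemma edge0_of_adj u v : G u v -> centre G u = centre G v -> edge0 G u v.
Proof.
move=> uv e; rewrite edge0E e eqxx; have /eqP -> /= := adj_neq uv.
apply/negPn/negP; rewrite negb_or => /andP[cu cv].
case: (good_kind u gG) => [a b c k|r sp|l r sp t].
- by rewrite (central_K4 k) in cu.
- by rewrite (central_spine sp) in cu.
have : edge0 G v l.
  rewrite edge0E -e (centre_apex bf sp t) (centre_spine bf sp) eqxx.
  rewrite (central_spine sp) orbT /= andbT.
  by apply: contraNneq cv => ->; exact: central_spine sp.
have ul : edge0 G u l by apply/(edge0_apex bf _ sp t); left.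
case/edge0P => _ [vl _ _]; case/edge0P: ul => _ [ul _ _].
have : edge0 G u v by apply/edge0P; exists l.
by rewrite edge0E (negbTE cu) (negbTE cv) !andbF.
Qed.

End Good.

(** * Induced copies of good graphs *)
Section InducedCopy.
Variables (V W : finType) (H : sgraph V) (G : sgraph W) (f : V -> W).
Hypotheses (gH : good H) (gG : good G) (fHG : induced_copy H G f).
Let bfH : bowtie_free H := proj1 gH.
Let bfG : bowtie_free G := proj1 gG.
Let fI : injective f := proj1 fHG.
Let fE : forall x y, G (f x) (f y) = H x y := proj2 fHG.

Lemma triangle_map x y z : triangle H x y z -> triangle G (f x) (f y) (f z).
Proof. by case=> xy xz yz; split; rewrite fE. Qed.

Lemma spine_map l r : spine H l r -> spine G (f l) (f r).
Proof.
case=> y [z [ty tz yz nyz]]; exists (f y), (f z).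
by split; [exact: triangle_map | exact: triangle_map | move/fI | rewrite fE].
Qed.

Lemma K4_on_map v a b c : K4_on H v a b c -> K4_on G (f v) (f a) (f b) (f c).
Proof. by case=> *; split; exact: triangle_map. Qed.

Lemma central_map x : central G (f x) = central H x.
Proof.
case: (good_kind x gH) => [a b c k|r sp|l r sp t].
- by rewrite (central_K4 k) (central_K4 (K4_on_map k)).
- by rewrite (central_spine sp) (central_spine (spine_map sp)).
- rewrite (negbTE (not_central_apex bfH sp t)); apply: negbTE.
  exact (not_central_apex bfG (spine_map sp) (triangle_map t)).
Qed.

Lemma centre_map x : centre G (f x) = f @: centre H x.
Proof.
case: (good_kind x gH) => [a b c k|r sp|l r sp t].
- by rewrite (centre_K4 bfH k) (centre_K4 bfG (K4_on_map k)) !imsetU !imset_set1.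
- by rewrite (centre_spine bfH sp) (centre_spine bfG (spine_map sp)) !imsetU !imset_set1.
- rewrite (centre_apex bfH sp t) (centre_apex bfG (spine_map sp) (triangle_map t)).
  by rewrite !imsetU !imset_set1.
Qed.

Lemma eq_centre_map x y : (centre G (f x) == centre G (f y)) = (centre H x == centre H y).
Proof. by rewrite !centre_map (inj_eq (imset_inj fI)). Qed.

Lemma edge0_map x y : edge0 G (f x) (f y) = edge0 H x y.
Proof. by rewrite !edge0E // (inj_eq fI) eq_centre_map !central_map. Qed.

Lemma edge1_map x y : edge1 G (f x) (f y) = edge1 H x y.
Proof. by rewrite /edge1 edge0_map fE. Qed.

(** The other end of a chimney is in the centre of [f x], which is an image. *)
Lemma spine_preimage x w : spine G (f x) w -> exists2 y, w = f y & spine H x y.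
Proof.
move=> sp; have := central_spine sp; have := centre_spine bfG sp.
have := card_centre_spine gG sp; rewrite central_map {1}centre_map card_imset // => c2 E cx.
have [r sr] := chimney_end gH cx c2; exists r => //.
have : w \in centre G (f x) by rewrite E !inE eqxx orbT.
rewrite centre_map (centre_spine bfH sr) => /imsetP[y].
rewrite !inE => /orP[] /eqP -> // wx.
by have [y' [z [[xw _ _] _ _ _]]] := sp; case: (adj_neq xw).
Qed.

Lemma in_K4_map x : in_K4 G (f x) <-> in_K4 H x.
Proof. by rewrite !in_K4_centre // centre_map card_imset. Qed.

Lemma chimney_centre_map x y : chimney_centre G (f x) (f y) <-> chimney_centre H x y.
Proof.
rewrite !chimney_centreP; split; last exact: spine_map.
by case/spine_preimage => z /fI <-.
Qed.

Lemma copy_K4_centre h i j : copy K4 G h -> h j \in centre G (h i).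
Proof.
move=> hG; have [->|ij] := eqVneq j i.
  by apply/mem_centre/central_card4/in_K4_centre => //; exists h; split=> //; exists i.
have hj : in_K4 G (h j) by exists h; split=> //; exists j.
have /subsetPn [k _] : ~~ ([set: 'I_4] \subset [set i; j]).
  apply: contraTN isT => /subset_leq_card; rewrite cardsT card_ord cards2.
  by case: (_ != _).
rewrite !inE negb_or => /andP[ki kj].
rewrite (central_card4 gG) /=; last exact/in_K4_centre.
apply/connect1/edge0P; exists (h k).
by split; apply: K4_copy hG _ _ _; rewrite // eq_sym.
Qed.

Variables (leH : rel V) (le : rel W).
Hypothesis leE : forall x y, leH x y = le (f x) (f y).

Lemma strict_map x y : strict leH x y = strict le (f x) (f y).
Proof. by rewrite /strict leE (inj_eq fI). Qed.

Lemma admissible_map : admissible G le -> admissible H leH.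
Proof.
case=> -[rf asym tr tot] Hc Hck Hcn Hn Hno; split.
- split=> [x|x y|y x z|x y]; rewrite !leE //.
  + by move/asym/fI.
  + exact: tr.
- move=> v x y z xv zv; rewrite !leE => xy yz.
  have := Hc (f v) (f x) (f y) (f z).
  by rewrite centre_map !mem_imset //; apply.
- move=> x x' y /chimney_centre_map cx /in_K4_map ky.
  by rewrite strict_map; exact: Hck cx ky.
- by move=> x y; rewrite -!central_map strict_map; exact: Hcn.
- move=> v x y z xv zv; rewrite !leE => xy yz.
  have := Hn (f v) (f x) (f y) (f z); rewrite !inE !central_map !eq_centre_map.
  by rewrite !inE in xv zv; apply.
- move=> v w x y; rewrite -!central_map -eq_centre_map !strict_map => cv cw vw xv yw.
  by apply: Hno => //; rewrite centre_map mem_imset.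
Qed.

(** The vertices required by the unary relations at [f x] belong to the centre of
[f x], so they are in the image of [f]. *)
Lemma L1_map : embedding (L1 H leH) (L1 G le) f.
Proof.
split=> //.
- case=> [||i] x; apply: asbool_equiv_eq.
  + split=> [[w [xw /chimney_centreP sp']]|[y [xy cy]]].
      have [y wy sp] := spine_preimage sp'.
      by exists y; rewrite strict_map -wy; split=> //; apply/chimney_centreP.
    by exists (f y); rewrite -strict_map; split=> //; apply/chimney_centre_map.
  + split=> [[w [xw cw]]|[y [xy cy]]].
      have [y wy sp] := spine_preimage (spine_sym ((chimney_centreP _ _ _).1 cw)).
      by exists y; rewrite strict_map -wy; split=> //; apply/chimney_centreP/spine_sym.
    by exists (f y); rewrite -strict_map; split=> //; apply/chimney_centre_map.
  + split=> [[h [hG hle hi]]|[h [[hI hH] hle hi]]]; last first.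
      exists (f \o h); split=> /=; last by rewrite hi.
        by split=> [|j k /hH]; [exact: inj_comp | rewrite fE].
      by move=> j k /hle; rewrite strict_map.
    have /choice [h' h'E] : forall j, exists y, h j = f y.
      move=> j; have := copy_K4_centre i j hG.
      by rewrite hi centre_map => /imsetP[y _ ->]; exists y.
    exists h'; split; last by apply: fI; rewrite -h'E.
      case: hG => hI hG; split=> [j k e|j k /hG]; last by rewrite !h'E fE.
      by apply: hI; rewrite !h'E e.
    by move=> j k /hle; rewrite strict_map !h'E.
- by case=> x y /=; rewrite ?edge0_map ?edge1_map ?leE.
Qed.
End InducedCopy.

Lemma embedding_comp U B V1 V2 V3 (M1 : structure U B V1) (M2 : structure U B V2)
    (M3 : structure U B V3) f g :
  embedding M1 M2 f -> embedding M2 M3 g -> embedding M1 M3 (g \o f).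
Proof.
move=> [fI fu fb] [gI gu gb]; split; first exact: inj_comp.
- by move=> s x; rewrite /= gu fu.
- by move=> s x y; rewrite /= gb fb.
Qed.

Lemma embedding_factor U B V1 V2 V3 (M1 : structure U B V1) (M2 : structure U B V2)
    (M3 : structure U B V3) f g :
  embedding M1 M3 (g \o f) -> embedding M2 M3 g -> embedding M1 M2 f.
Proof.
move=> [fI fu fb] [gI gu gb]; split.
- by move=> x y e; apply: fI; rewrite /= e.
- by move=> s x; rewrite -gu -fu.
- by move=> s x y; rewrite -gb -fb.
Qed.

Lemma rooted_iso_trans V1 V2 V3 (M1 : rooted V1) (M2 : rooted V2) (M3 : rooted V3) :
  rooted_iso M1 M2 -> rooted_iso M2 M3 -> rooted_iso M1 M3.
Proof.
move=> [f [fB fe f1 f2]] [g [gB ge g1 g2]]; exists (g \o f).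
split; [exact: bij_comp | exact: embedding_comp fe ge | |] => /=.
- by rewrite f1.
- by rewrite f2.
Qed.

Lemma rooted_iso_sym V1 V2 (M1 : rooted V1) (M2 : rooted V2) :
  rooted_iso M1 M2 -> rooted_iso M2 M1.
Proof.
move=> [f [[g fK gK] fe f1 f2]]; exists g; split.
- by exists f.
- apply: (embedding_factor _ fe); case: (fe) => fI fu fb.
  by split=> [x y|s x|s x y] /=; rewrite ?gK.
- by rewrite -f1.
- by rewrite -f2.
Qed.

(** Supports of pairs are images of supports of pairs, so the rooted structures
they induce are isomorphic. *)
Lemma L2_map (V W : finType) (H : sgraph V) (G : sgraph W) (f : V -> W)
    (leH : rel V) (le : rel W) :
  good H -> good G -> induced_copy H G f ->
  (forall x y, leH x y = le (f x) (f y)) ->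
  embedding (L2 H leH) (L2 G le) f.
Proof.
move=> gH gG fHG leE; have [fI _] := fHG.
have L1e := L1_map gH gG fHG leE; have [_ Lu Lb] := L1e.
have suppE u v : pair_support G (f u) (f v) = f @: pair_support H u v.
  by rewrite /pair_support !imsetU !imset_set1 !(centre_map gH gG fHG).
have iso u v : rooted_iso (pair_rooted H leH u v) (pair_rooted G le (f u) (f v)).
  have memf (x : {x | x \in pair_support H u v}) : f (val x) \in pair_support G (f u) (f v).
    by rewrite suppE mem_imset //; exact: valP.
  pose g x : {y | y \in pair_support G (f u) (f v)} := exist _ (f (val x)) (memf x).
  have gI : injective g by move=> x y /(congr1 val) /fI /val_inj.
  exists g; split.
  - apply: inj_card_bij gI _; rewrite !card_sig.
    by rewrite (eq_card (B := pair_support G (f u) (f v))) // suppE card_imset //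
       (eq_card (A := [pred x | x \in pair_support H u v]) (B := pair_support H u v)).
  - split=> // [s x|s x y]; first exact: Lu.
    exact: Lb.
  - exact: val_inj.
  - exact: val_inj.
split=> //; case=> [b|t] x y; first exact: Lb.
rewrite /= (strict_map fHG leE); congr (_ && _); apply: asbool_equiv_eq.
split; first exact: rooted_iso_trans (iso x y).
exact: rooted_iso_trans (rooted_iso_sym (iso x y)).
Qed.

(** * Coordinates in an ordered good graph *)
Section Rank.
Variables (T : finType) (A : {set T}) (R : rel T).

Definition rank x := #|[set y in A | R y x]|.

Lemma rank_lt x : x \in A -> ~~ R x x -> rank x < #|A|.
Proof.
move=> xA xx; apply: proper_card; apply/properP; split.
  by apply/subsetP=> y; rewrite inE => /andP[].
by exists x; rewrite // inE xA.
Qed.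

Lemma ltn_rank x y : x \in A -> ~~ R x x -> {in A, forall z, R z x -> R z y} ->
  R x y -> rank x < rank y.
Proof.
move=> xA xx tr xy; apply: proper_card; apply/properP; split.
  by apply/subsetP=> z; rewrite !inE => /andP[zA zx]; rewrite zA tr.
by exists x; rewrite !inE xA ?xy ?(negbTE xx).
Qed.
End Rank.

Definition lex3 (p q : nat * nat * nat) : bool :=
  (p.1.1 < q.1.1) || ((p.1.1 == q.1.1) &&
    ((p.1.2 < q.1.2) || ((p.1.2 == q.1.2) && (p.2 < q.2)))).

Lemma lex3_asym p q : lex3 p q -> ~~ lex3 q p.
Proof.
case: p q => [[a b] c] [[a' b'] c']; rewrite /lex3 /=.
by case: (ltngtP a a') => //=; case: (ltngtP b b') => //=; case: (ltngtP c c').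
Qed.

(** The vertices of an ordered good graph are compared by kind (end of a chimney,
vertex of a K_4, apex), then by the rank of their centre among the centres of the
same size, then by their rank inside the set of vertices of the same kind with the
same centre. *)
Section Keys.
Variables (V : finType) (G : sgraph V) (le : rel V).
Hypotheses (gG : good G) (aG : admissible G le).

Let le_tot : total le. Proof. by case: (adm_linear aG). Qed.
Let le_asym : antisymmetric le. Proof. by case: (adm_linear aG). Qed.
Let le_tr : transitive le. Proof. by case: (adm_linear aG). Qed.

Lemma strict_irr x : ~~ strict le x x.
Proof. by rewrite /strict eqxx. Qed.

Lemma strict_asym x y : strict le x y -> ~~ strict le y x.
Proof.
case/andP=> xy lexy; apply/negP=> /andP[_ leyx].
by move/eqP: xy; apply; apply: le_asym; rewrite lexy.
Qed.

Lemma strict_total x y : x != y -> strict le x y || strict le y x.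
Proof. by move=> xy; rewrite /strict xy eq_sym xy /= le_tot. Qed.

Lemma not_strict x y : x != y -> strict le x y = ~~ strict le y x.
Proof.
move=> xy; apply/idP/idP => [/strict_asym //|/negbTE n].
by have := strict_total xy; rewrite n orbF.
Qed.

Lemma strict_tr : transitive (strict le).
Proof.
move=> y x z /andP[xy lexy] /andP[yz leyz]; rewrite /strict (le_tr lexy leyz) andbT.
by apply: contraNneq xy => e; apply/eqP/le_asym; rewrite lexy e leyz.
Qed.

Definition before (C D : {set V}) : bool :=
  [forall x in C, forall y in D, strict le x y].

Lemma beforeP (C D : {set V}) : reflect {in C & D, forall x y, strict le x y} (before C D).
Proof.
apply: (iffP forall_inP) => H x; first by move=> y xC; move/forall_inP: (H x xC); apply.
by move=> xC; apply/forall_inP=> y yD; apply: H.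
Qed.

Lemma centre_neq0 v : exists x, x \in centre G v.
Proof.
by apply/card_gt0P; case: (card_centreP gG v) => ->.
Qed.

(** Distinct centres are disjoint intervals, so one comparison between their
elements decides all the others; this lemma moves the upper element and the next
one the lower element. *)
Lemma centre_separated u v w x x' :
  u \in centre G v -> w \in centre G x -> centre G v != centre G x ->
  strict le u w -> x' \in centre G x -> strict le u x'.
Proof.
move=> uv wx vx uw x'x.
have disj y : y \in centre G v -> y \in centre G x -> False.
  move=> yv yx; move/eqP: vx; apply.
  by rewrite -(centre_of_mem yv) (centre_of_mem yx).
have ne : u != x' by apply/eqP=> e; apply: (disj u); rewrite // e.
rewrite not_strict //; apply/negP=> /andP[_ x'u].
apply: (disj u uv); apply: (adm_centre aG) x'x wx x'u _.
by case/andP: uw.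
Qed.

Lemma centre_separated_l u v w x u' :
  u \in centre G v -> w \in centre G x -> centre G v != centre G x ->
  strict le u w -> u' \in centre G v -> strict le u' w.
Proof.
move=> uv wx vx uw u'v.
have disj y : y \in centre G v -> y \in centre G x -> False.
  move=> yv yx; move/eqP: vx; apply.
  by rewrite -(centre_of_mem yv) (centre_of_mem yx).
have ne : u' != w by apply/eqP=> e; apply: (disj u'); rewrite // e.
rewrite not_strict //; apply/negP=> /andP[_ wu'].
apply: (disj w) wx; apply: (adm_centre aG) uv u'v _ wu'.
by case/andP: uw.
Qed.

Lemma before_centres u w v x :
  u \in centre G v -> w \in centre G x -> centre G v != centre G x ->
  strict le u w -> before (centre G v) (centre G x).
Proof.
move=> uv wx vx uw; apply/beforeP=> u' w' u'v w'x.
exact: centre_separated u'v wx vx (centre_separated_l uv wx vx uw u'v) w'x.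
Qed.

Lemma before_total v x : centre G v != centre G x ->
  before (centre G v) (centre G x) || before (centre G x) (centre G v).
Proof.
move=> vx; have [u uv] := centre_neq0 v; have [w wx] := centre_neq0 x.
have uw : u != w.
  by apply: contraNneq vx => e; rewrite -(centre_of_mem uv) -(centre_of_mem wx) e.
case/orP: (strict_total uw) => lt.
  by rewrite (before_centres uv wx).
by rewrite (before_centres wx uv) ?orbT // eq_sym.
Qed.

Lemma before_irr v : ~~ before (centre G v) (centre G v).
Proof.
have [u uv] := centre_neq0 v.
by apply/negP=> /beforeP H; have := H u u uv uv; rewrite (negbTE (strict_irr u)).
Qed.

Lemma before_tr v C D : before C (centre G v) -> before (centre G v) D -> before C D.
Proof.
have [u uv] := centre_neq0 v.
move=> /beforeP Cv /beforeP vD; apply/beforeP=> x y xC yD.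
exact: strict_tr (Cv x u xC uv) (vD u y uv yD).
Qed.

Definition same_size_centres v : {set {set V}} :=
  [set C in [set centre G w | w in V] | #|C| == #|centre G v|].

Definition level v := rank (same_size_centres v) before (centre G v).

Definition group v : {set V} :=
  [set w | (centre G w == centre G v) && (central G w == central G v)].

Definition place v := rank (group v) (strict le) v.

Definition category v : nat :=
  if central G v then (#|centre G v| == 4) : nat else 2.

Definition key v := (category v, level v, place v).

Lemma mem_same_size v : centre G v \in same_size_centres v.
Proof. by rewrite inE eqxx andbT imset_f. Qed.

Lemma mem_group v : v \in group v.
Proof. by rewrite inE !eqxx. Qed.

Lemma level_lt v : level v < #|same_size_centres v|.
Proof. by apply: rank_lt (mem_same_size v) (before_irr v). Qed.

Lemma place_lt v : place v < #|group v|.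
Proof. by apply: rank_lt (mem_group v) (strict_irr v). Qed.

Lemma group_central v : central G v -> group v = centre G v.
Proof.
move=> cv; apply/setP=> w; rewrite inE cv eqb_id; apply/andP/idP => [[/eqP <- cw]|wv].
  exact: mem_centre.
by rewrite (centre_of_mem wv) eqxx; move: wv; rewrite inE => /andP[].
Qed.

Lemma before_level v w : #|centre G v| = #|centre G w| ->
  before (centre G v) (centre G w) -> level v < level w.
Proof.
move=> vw bvw; have ss : same_size_centres v = same_size_centres w.
  by rewrite /same_size_centres vw.
rewrite /level -ss; apply: (ltn_rank (mem_same_size v) (before_irr v) _ bvw).
by move=> C _ Cv; exact: before_tr Cv bvw.
Qed.

Lemma level_inj v w : #|centre G v| = #|centre G w| -> level v = level w ->
  centre G v = centre G w.
Proof.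
move=> vw e; apply/eqP; apply: contraT => /before_total /orP[] /before_level.
  by rewrite e ltnn; apply.
by rewrite e ltnn; apply.
Qed.

Lemma noncentral_card v : ~~ central G v -> #|centre G v| = 2.
Proof.
move=> cv; case: (card_centreP gG v) => // /(central_card4 gG) c.
by rewrite c in cv.
Qed.

Lemma category_card v w : category v = category w -> central G v = central G w /\
  #|centre G v| = #|centre G w|.
Proof.
rewrite /category; have := @noncentral_card v; have := @noncentral_card w.
case: (card_centreP gG v) (card_centreP gG w) => -> [] ->;
  case: (central G v); case: (central G w) => //= H1 H2; by have := H1 isT; have := H2 isT.
Qed.

Lemma category_strict v w : category v < category w -> strict le v w.
Proof.
rewrite /category; have [cv|cv] := boolP (central G v); last first.
  by case: ifP => // _; case: eqP.
have [cw|cw _] := boolP (central G w); last exact: (adm_central aG).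
case: (card_centreP gG v) => v4; last by rewrite v4 /=; case: (_ == _).
case: (card_centreP gG w) => w4; rewrite v4 w4 // => _.
have [x sp] := chimney_end gG cv v4.
apply: (adm_chimney_K4 aG (x' := x)); first exact/chimney_centreP.
exact/in_K4_centre.
Qed.

Lemma before_strict v w : central G v = central G w ->
  before (centre G v) (centre G w) -> strict le v w.
Proof.
move=> cvw bvw; have [cv|cv] := boolP (central G v).
  by apply: (beforeP _ _ bvw); apply: mem_centre; rewrite // -cvw.
have [x xv] := centre_neq0 v; have [y yw] := centre_neq0 w.
apply: (adm_noncentral_order aG cv _ _ xv yw); first by rewrite -cvw.
  by apply: contraTneq bvw => ->; exact: before_irr.
exact: (beforeP _ _ bvw).
Qed.

Lemma strict_lex v w : strict le v w -> lex3 (key v) (key w).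
Proof.
move=> vw; rewrite /lex3 /=.
case: (ltngtP (category v) (category w)) => [//|/category_strict|e] /=.
  by rewrite (negbTE (strict_asym vw)).
have [cvw svw] := category_card e.
have [evw|nvw] := eqVneq (centre G v) (centre G w).
  have -> : level v = level w by rewrite /level /same_size_centres evw.
  rewrite eqxx ltnn /=.
  have gvw : group v = group w by apply/setP=> x; rewrite !inE evw cvw.
  rewrite /place -gvw; apply: (ltn_rank (mem_group v) (strict_irr v) _ vw).
  by move=> z _ zv; exact: strict_tr zv vw.
case/orP: (before_total nvw) => b; first by rewrite (before_level svw b).
by have := before_strict (esym cvw) b; rewrite (negbTE (strict_asym vw)).
Qed.

Lemma strict_lexE v w : strict le v w = lex3 (key v) (key w).
Proof.
apply/idP/idP; first exact: strict_lex.
have [->|vw] := eqVneq v w; first by move=> H; have := lex3_asym H; rewrite H.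
by rewrite (not_strict vw); apply: contraL => /strict_lex; exact: lex3_asym.
Qed.

Lemma key_inj : injective key.
Proof.
move=> v w e; apply/eqP; apply: contraT => /strict_total.
have irr p : lex3 p p = false by apply: negbTE; apply/negP => H; have := lex3_asym H; rewrite H.
by rewrite !strict_lexE e irr.
Qed.

End Keys.

(** * Disjoint unions of chimneys and copies of K_4 *)
Section Slots.
Variable n : nat.
Local Notation N := n.+2.

(** In the first summand [inl (a, inr b)] is an end and [inl (a, inl c)] an apex of
the chimney [a].  There are at least two chimneys, K_4s and apexes, whatever [n]
is, so that each chimney is an induced one. *)
Definition slot : finType := (('I_N * ('I_N + bool)) + ('I_N * 'I_4))%type.

Definition block (p : slot) : 'I_N + 'I_N :=
  match p with inl (a, _) => inl a | inr (a, _) => inr a end.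

Definition slot_central (p : slot) : bool :=
  if p is inl (_, inl _) then false else true.

(** The counterpart of [key]: the standard order of the slots is the lexicographic
order of these triples. *)
Definition slot_key (p : slot) : nat * nat * nat :=
  match p with
  | inl (a, inr b) => (0, a : nat, b : nat)
  | inr (a, b) => (1, a : nat, b : nat)
  | inl (a, inl b) => (2, a : nat, b : nat)
  end.

Section Coordinates.
Variables (V : finType) (G : sgraph V) (le : rel V).
Hypotheses (gG : good G) (aG : admissible G le).
Hypothesis few_centres : forall v, #|same_size_centres G v| <= N.
Hypothesis few_apexes : forall v, ~~ central G v -> #|group G v| <= N.

Definition coordinates (v : V) : slot :=
  if central G v then
    if #|centre G v| == 4 then inr (inord (level G le v), inord (place G le v))
    else inl (inord (level G le v), inr (place G le v != 0))
  else inl (inord (level G le v), inl (inord (place G le v))).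

Lemma level_bound v : level G le v < N.
Proof. exact: leq_trans (level_lt le gG v) (few_centres v). Qed.

Lemma slot_key_coordinates v : slot_key (coordinates v) = key G le v.
Proof.
rewrite /coordinates /key /category; have lv := level_bound v.
have := place_lt G le v; have [cv|cv] := boolP (central G v).
  rewrite group_central //.
  case: (card_centreP gG v) => -> /= pv; rewrite !inordK //.
  by case: (place G le v) pv => [|[]].
by move=> pv; rewrite /= !inordK // (leq_trans pv (few_apexes cv)).
Qed.

Lemma slot_central_coordinates v : slot_central (coordinates v) = central G v.
Proof. by rewrite /coordinates; case: ifP => //; case: ifP. Qed.

Lemma block_coordinates v w :
  (block (coordinates v) == block (coordinates w)) = (centre G v == centre G w).
Proof.
have B x : block (coordinates x) =
    if #|centre G x| == 4 then inr (inord (level G le x)) else inl (inord (level G le x)).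
  rewrite /coordinates; case: ifP => [_|cx]; first by case: ifP.
  by rewrite (noncentral_card gG) ?cx.
have lv := level_bound v; have lw := level_bound w.
apply/idP/eqP => [|e]; last first.
  by rewrite !B /level /same_size_centres e.
rewrite !B => E; apply: (level_inj gG aG).
  by case: (card_centreP gG v) (card_centreP gG w) E => -> [] ->.
have {}E : inord (level G le v) == inord (level G le w) :> 'I_N.
  by move: E; do 2!case: ifP.
by move/eqP/(congr1 val): E; rewrite /= !inordK.
Qed.

Lemma coordinates_inj : injective coordinates.
Proof.
move=> v w e; apply: (key_inj gG aG).
by rewrite -!slot_key_coordinates e.
Qed.

Lemma strict_coordinates v w :
  strict le v w = lex3 (slot_key (coordinates v)) (slot_key (coordinates w)).
Proof. by rewrite (strict_lexE gG aG) !slot_key_coordinates. Qed.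
End Coordinates.

Definition slot_adj (p q : slot) : bool :=
  [&& p != q, block p == block q & slot_central p || slot_central q].

Lemma slot_adj_sym : symmetric slot_adj.
Proof. by move=> p q; rewrite /slot_adj eq_sym (eq_sym (block p)) orbC. Qed.

(** A graph on the slots whose triangles all lie within blocks: the slots with any
harmless set of E_1-edges added.  Its centres do not depend on these edges. *)
Section FullGraph.
Variable K : sgraph slot.
Hypotheses (bf : bowtie_free K) (slot_sub : forall p q, slot_adj p q -> K p q).
Hypothesis K_block : forall p q, K p q -> block p = block q -> slot_adj p q.
Hypothesis K_triangle : forall p q s, triangle K p q s -> block p = block q.

Lemma slot_apex a b c : triangle K (inl (a, inr b)) (inl (a, inr (~~ b))) (inl (a, inl c)).
Proof.
by split; apply: slot_sub; rewrite /slot_adj /= eqxx !andbT; apply/eqP; case: b.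
Qed.

Lemma slot_apex_nonadj a c c' : ~~ K (inl (a, inl c)) (inl (a, inl c')).
Proof. by apply/negP=> /K_block /(_ erefl); rewrite /slot_adj /= !andbF. Qed.

Lemma slot_spine a b : spine K (inl (a, inr b)) (inl (a, inr (~~ b))).
Proof.
exists (inl (a, inl ord0)), (inl (a, inl ord_max)).
by split=> //; [exact: slot_apex | exact: slot_apex | exact: slot_apex_nonadj].
Qed.

Lemma slot_K4 a (i j k l : 'I_4) : uniq [:: i; j; k; l] ->
  K4_on K (inr (a, i)) (inr (a, j)) (inr (a, k)) (inr (a, l)).
Proof.
have A x y : x != y -> K (inr (a, x)) (inr (a, y)).
  by move=> xy; apply: slot_sub; rewrite /slot_adj /= eqxx !andbT; apply: contraNneq xy => -[->].
rewrite /= !inE !negb_or !andbT => /and3P[/and3P[ij ik il] /andP[jk jl] kl].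
by split; split; apply: A.
Qed.

Lemma slot_K4_at a i : exists j k l, K4_on K (inr (a, i)) (inr (a, j)) (inr (a, k)) (inr (a, l)).
Proof.
have /andP[u /eqP s4] : uniq (rem i (enum 'I_4)) && (size (rem i (enum 'I_4)) == 3).
  by rewrite rem_uniq ?enum_uniq // size_rem ?mem_enum // size_enum_ord.
have ni : i \notin rem i (enum 'I_4) by rewrite mem_rem_uniqF ?enum_uniq.
case: (rem _ _) s4 u ni => [|j [|k [|l []]]] // _ u ni.
by exists j, k, l; apply: slot_K4; rewrite cons_uniq ni.
Qed.

Lemma slot_good : good K.
Proof.
split=> // -[[a [c|b]]|[a i]].
- pose c' : 'I_N := if c == ord0 then ord_max else ord0.
  have cc' : c <> c' by rewrite /c'; case: (c =P ord0) => // -> /(congr1 val).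
  apply: (@seed_good _ K (inl (a, inr true)) (inl (a, inr false)) (inl (a, inl c))
    (inl (a, inl c'))); last by constructor 3.
  apply: SeedChimney; [exact: (slot_apex a true) | exact: (slot_apex a true) | |
    exact: slot_apex_nonadj].
  by case.
- have [y [z [ty tz yz nyz]]] := slot_spine a b.
  by apply: (seed_good (SeedChimney ty tz yz nyz)); constructor 1.
- have [j [k [l k4]]] := slot_K4_at a i.
  by apply: (seed_good (SeedK4 k4)); constructor 1.
Qed.
Let gK := slot_good.

Lemma slot_centralE p : central K p = slot_central p.
Proof.
case: p => [[a [c|b]]|[a i]] /=.
- exact/negbTE/(not_central_apex bf (slot_spine a true) (slot_apex a true c)).
- exact: central_spine (slot_spine a b).
- by have [j [k [l k4]]] := slot_K4_at a i; exact: central_K4 k4.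
Qed.

Lemma mem_centre_block p q : q \in centre K p -> block q = block p.
Proof.
rewrite inE => /andP[_ pq]; apply/eqP.
have := connect_closed_sub (S := [set s | block s == block p]) _ _ pq; rewrite !inE.
apply=> // x y; rewrite !inE => /eqP <- /edge0P[z t].
by rewrite eq_sym (K_triangle t).
Qed.

Lemma centre_chimney_slot a x :
  centre K (inl (a, x)) = [set inl (a, inr false); inl (a, inr true)].
Proof.
case: x => [c|[]]; first exact: (centre_apex bf (slot_spine a false) (slot_apex a false c)).
  by rewrite setUC; exact: (centre_spine bf (slot_spine a true)).
exact: (centre_spine bf (slot_spine a false)).
Qed.

Lemma centre_K4_slot a i : centre K (inr (a, i)) = [set inr (a, j) | j : 'I_4].
Proof.
have [j [k [l k4]]] := slot_K4_at a i.
apply/eqP; rewrite eqEcard (card_centre_K4 bf k4).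
rewrite (leq_trans (leq_imset_card _ _)) ?card_ord // andbT.
apply/subsetP=> -[[b x]|[b x]] /mem_centre_block //= [->].
exact: imset_f.
Qed.

Lemma slot_centreE p q : (centre K p == centre K q) = (block p == block q).
Proof.
apply/eqP/eqP => [e|].
  have [x xp] := centre_neq0 gK p.
  by rewrite -(mem_centre_block xp); apply: mem_centre_block; rewrite -e.
case: p q => [[a x]|[a i]] [[b y]|[b j]] //= [->].
  by rewrite !centre_chimney_slot.
by rewrite !centre_K4_slot.
Qed.

Lemma slot_few_centres p : #|same_size_centres K p| <= N.
Proof.
have [F HF] : exists F : 'I_N -> slot, forall q,
    #|centre K q| = #|centre K p| -> exists a, centre K q = centre K (F a).
  case: p => [[a x]|[a i]].
    exists (fun b => inl (b, inr true)) => -[[b y]|[b j]].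
      by exists b; apply/eqP; rewrite slot_centreE.
    have [j1 [k [l k4]]] := slot_K4_at b j.
    rewrite (card_centre_K4 bf k4) centre_chimney_slot cards2.
    by case: (_ != _).
  exists (fun b => inr (b, ord0)) => -[[b y]|[b j]].
    have [j1 [k [l k4]]] := slot_K4_at a i.
    rewrite (card_centre_K4 bf k4) centre_chimney_slot cards2.
    by case: (_ != _).
  by exists b; apply/eqP; rewrite slot_centreE.
apply: leq_trans (_ : #|[set centre K (F a) | a : 'I_N]| <= _).
  apply/subset_leq_card/subsetP=> C; rewrite inE => /andP[/imsetP[q _ ->] /eqP /HF[a ->]].
  exact: imset_f.
by rewrite (leq_trans (leq_imset_card _ _)) ?card_ord.
Qed.

Lemma slot_few_apexes p : ~~ central K p -> #|group K p| <= N.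
Proof.
rewrite slot_centralE; case: p => [[a [c|b]]|[a i]] //= _.
pose F (x : 'I_N) : slot := inl (a, inl x).
apply: leq_trans (_ : #|[set F x | x : 'I_N]| <= _).
  apply/subset_leq_card/subsetP=> q; rewrite inE slot_centreE !slot_centralE.
  case: q => [[b [c'|b']]|[b i]] //= /andP[/eqP[->] //] _.
  by apply/imsetP; exists c'.
by rewrite (leq_trans (leq_imset_card _ _)) ?card_ord.
Qed.

Section Embed.
Variables (V : finType) (H : sgraph V) (leH : rel V) (leK : rel slot).
Hypotheses (gH : good H) (aH : admissible H leH) (aK : admissible K leK).
Hypothesis small : #|V| <= N.

(** Coordinates in [K] are an injection of the slots into themselves, hence a
bijection, by finiteness.  The embedding sends a vertex of [H] to the slot that
has the same coordinates. *)
Lemma exists_block_embedding : exists g : V -> slot,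
  [/\ injective g, forall x y, leH x y = leK (g x) (g y),
     forall x, slot_central (g x) = central H x
   & forall x y, (block (g x) == block (g y)) = (centre H x == centre H y)].
Proof.
have fc v : #|same_size_centres H v| <= N.
  apply: leq_trans small; apply: leq_trans (leq_imset_card (centre H) _).
  by apply/subset_leq_card/subsetP=> C; rewrite inE => /andP[].
have fa v : ~~ central H v -> #|group H v| <= N by move=> _; exact: leq_trans (max_card _) small.
pose cH := coordinates H leH; pose cK := coordinates K leK.
have cKI : injective cK := coordinates_inj gK aK slot_few_centres slot_few_apexes.
have [c' cK' c'K] := injF_bij cKI.
have cHI : injective cH := coordinates_inj gH aH fc fa.
exists (c' \o cH); split=> [|x y|x|x y] /=.
- exact: inj_comp (can_inj c'K) cHI.
- have [->|xy] := eqVneq x y.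
    have [[rH _ _ _] [rK _ _ _]] := (adm_linear aH, adm_linear aK).
    by rewrite rH rK.
  have E : strict leH x y = strict leK (c' (cH x)) (c' (cH y)).
    rewrite (strict_coordinates gH aH fc fa).
    by rewrite (strict_coordinates gK aK slot_few_centres slot_few_apexes) -/cK !c'K.
  by move: E; rewrite /strict xy (inj_eq (inj_comp (can_inj c'K) cHI)) xy.
- by rewrite -slot_centralE -(slot_central_coordinates K leK) -/cK c'K slot_central_coordinates.
- rewrite -slot_centreE -(block_coordinates gK aK slot_few_centres) -/cK !c'K.
  exact: (block_coordinates gH aH fc).
Qed.
End Embed.
End FullGraph.
End Slots.

(** * The target graph *)
Section Target.
Variable n : nat.
Local Notation P := (slot n).

Definition pattern_adj (E : {set P * P}) (p q : P) : bool :=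
  slot_adj p q || ((p, q) \in E).

(** The sets of E_1-edges that can be put on the slots: they join different blocks
and lie in no triangle. *)
Record pattern (E : {set P * P}) : Prop := {
  pattern_sym : forall p q, (p, q) \in E -> (q, p) \in E;
  pattern_block : forall p q, (p, q) \in E -> block p <> block q;
  pattern_triangle : forall p q s, (p, q) \in E ->
    pattern_adj E p s -> ~~ pattern_adj E q s }.

Lemma pattern0 : pattern set0.
Proof. by split=> [p q|p q|p q s]; rewrite inE. Qed.

Lemma pattern_adj_sym E : pattern E -> symmetric (pattern_adj E).
Proof.
move=> pE p q; rewrite /pattern_adj slot_adj_sym; congr (_ || _).
by apply/idP/idP; apply: pattern_sym.
Qed.

Lemma pattern_adj_irr E : pattern E -> irreflexive (pattern_adj E).
Proof.
move=> pE p; rewrite /pattern_adj /slot_adj eqxx /=.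
by apply/negP=> /(pattern_block pE).
Qed.

Definition pattern_graph E (pE : pattern E) : sgraph P :=
  SGraph (pattern_adj_sym pE) (pattern_adj_irr pE).

Lemma pattern_graph_block E (pE : pattern E) p q :
  pattern_graph pE p q -> block p = block q -> slot_adj p q.
Proof. by case/orP => // /(pattern_block pE). Qed.

Lemma pattern_graph_triangle E (pE : pattern E) p q s :
  triangle (pattern_graph pE) p q s -> block p = block q.
Proof.
case=> /orP[/and3P[_ /eqP //]|pq] ps qs.
by case/negP: (pattern_triangle pE pq ps).
Qed.

Variable S : hgraph ('I_n.+2 + 'I_n.+2)%type P {ffun {set P * P} -> {set P * P}}.
Hypotheses (linS : linear_hgraph S) (tfS : hgraph_triangle_free S).

(** The label of an edge consists of a guess and of a map from guesses to sets of
E_1-edges. *)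
Definition requested (e : hedge S) : {set P * P} := (lab e).2 (lab e).1.

Definition installed (e : hedge S) : {set P * P} :=
  if `[< pattern (requested e) >] then requested e else set0.

Lemma installed_pattern e : pattern (installed e).
Proof. by rewrite /installed; case: asboolP => // _; exact: pattern0. Qed.

Definition within (x y : point S * P) : bool := (x.1 == y.1) && slot_adj x.2 y.2.

Definition across (e : hedge S) (x y : point S * P) : bool :=
  [&& inc e (block x.2) == x.1, inc e (block y.2) == y.1 & (x.2, y.2) \in installed e].

Definition target_adj x y := within x y || [exists e, across e x y].

Lemma across_sym e (x y : point S * P) : across e x y -> across e y x.
Proof.
case/and3P=> ex ey xy; rewrite /across ex ey.
exact: pattern_sym (installed_pattern e) _ _ xy.
Qed.

Lemma within_sym (x y : point S * P) : within x y -> within y x.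
Proof. by rewrite /within eq_sym slot_adj_sym. Qed.

Lemma target_sym : symmetric target_adj.
Proof.
move=> x y; rewrite /target_adj; congr (_ || _).
  by apply/idP/idP; apply: within_sym.
by apply/existsP/existsP => -[e /across_sym]; exists e.
Qed.

Lemma target_irr : irreflexive target_adj.
Proof.
move=> x; rewrite /target_adj /within /slot_adj !eqxx /=; apply/existsP=> -[e].
by case/and3P=> _ _ /(pattern_block (installed_pattern e)).
Qed.

Definition target : sgraph (point S * P)%type := SGraph target_sym target_irr.

Lemma across_block e (x y : point S * P) : across e x y -> block x.2 != block y.2.
Proof. by case/and3P=> _ _ /(pattern_block (installed_pattern e)) /eqP. Qed.

Lemma across_no_triangle e (x y z : point S * P) : across e x y ->
  pattern_adj (installed e) x.2 z.2 -> pattern_adj (installed e) y.2 z.2 -> False.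
Proof.
case/and3P=> _ _ xy xz; apply/negP.
exact: pattern_triangle (installed_pattern e) _ _ _ xy xz.
Qed.

Lemma across_within e g (x y z : point S * P) :
  across e x y -> within x z -> across g y z -> False.
Proof.
move=> exy /andP[/eqP xz xz'] gyz.
have bxz : block x.2 = block z.2 by case/and3P: xz' => _ /eqP.
have eg : e = g.
  have := across_block exy; case/and3P: exy gyz => /eqP ex /eqP ey _ /and3P[/eqP gy /eqP gz _] bxy.
  by apply: linS bxy _ _; rewrite ?ey ?gy // ex bxz gz xz.
apply: (across_no_triangle (z := z) exy); rewrite /pattern_adj ?xz' //.
by case/and3P: gyz => _ _; rewrite eg => ->; rewrite orbT.
Qed.

(** Depending on how many sides of the triangle are E_1-edges, two or three
hyperedges are involved.  They coincide by linearity or by the absence of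
triangles of hyperedges, and the triangle lies in a single copy of the slots. *)
Lemma triangle_across e (x y z : point S * P) :
  across e x y -> target x z -> target y z -> False.
Proof.
move=> exy /orP[xz|/existsP[f fxz]] /orP[yz|/existsP[g gyz]].
- have := across_block exy; case/andP: xz => _ /and3P[_ /eqP -> _].
  by case/andP: yz => _ /and3P[_ /eqP -> _]; rewrite eqxx.
- exact: across_within exy xz gyz.
- exact: across_within (across_sym exy) yz fxz.
have [eg gf] : e = g /\ g = f.
  have bxy := across_block exy; have bxz := across_block fxz.
  have byz := across_block gyz.
  case/and3P: exy => /eqP ex /eqP ey _; case/and3P: fxz => /eqP fx /eqP fz _.
  case/and3P: gyz => /eqP gy /eqP gz _.
  apply: (tfS (a := block y.2) (b := block z.2) (c := block x.2)) => //.
  - by rewrite eq_sym.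
  - by rewrite eq_sym.
  - by rewrite ey.
  - by rewrite gz.
  - by rewrite fx.
apply: (across_no_triangle (z := z) exy); rewrite /pattern_adj.
  by rewrite eg gf; case/and3P: fxz => _ _ ->; rewrite orbT.
by rewrite eg; case/and3P: gyz => _ _ ->; rewrite orbT.
Qed.

Lemma target_triangle (x y z : point S * P) : triangle target x y z -> within x y.
Proof.
case=> /orP[//|/existsP[e exy]] xz yz.
by case: (triangle_across exy xz yz).
Qed.

(** A triangle within a chimney contains both ends. *)
Lemma slot_triangle_end i x t (a b : P) : x != inr t ->
  slot_adj (inl (i, x)) a -> slot_adj (inl (i, x)) b -> slot_adj a b ->
  a = inl (i, inr t) \/ b = inl (i, inr t).
Proof.
move=> xt /and3P[xa /eqP]; case: a xa => [[j y]|[j k]] //= xa [ej] cxa.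
move=> /and3P[xb /eqP]; case: b xb => [[j' z]|[j' k]] //= xb [ej'] cxb.
move=> /and3P[ab _ cab]; subst j j'.
case: x y z xt xa xb ab cxa cxb cab => [x|x] [y|y] [z|z] //=;
  rewrite ?(inj_eq (@inl_inj _ _)) ?xpair_eqE ?eqxx /= => xt xa xb ab _ _ _.
- by case: y z t {xt xa xb} ab => [] [] [] //; auto.
- by right; congr (inl (_, inr _)); case: x z t xt xb {xa ab} => [] [] [].
- by left; congr (inl (_, inr _)); case: x y t xt xa {xb ab} => [] [] [].
- by left; congr (inl (_, inr _)); case: x y t xt xa {xb ab} => [] [] [].
Qed.

Lemma slot_bowtie_free (p a b c d : P) :
  slot_adj p a -> slot_adj p b -> slot_adj a b ->
  slot_adj p c -> slot_adj p d -> slot_adj c d ->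
  [\/ a = c, a = d, b = c | b = d].
Proof.
case: p => [[i x]|[i x]] pa pb ab pc pd cd.
  have [t xt] : exists t, x != inr t.
    by case: x {pa pb pc pd} => [x|t]; [exists true | exists (~~ t); case: t].
  case: (slot_triangle_end xt pa pb ab) => ->;
    case: (slot_triangle_end xt pc pd cd) => ->;
    by [constructor 1 | constructor 2 | constructor 3 | constructor 4].
have inK4 q : slot_adj (inr (i, x)) q -> exists y, q = inr (i, y).
  by case/and3P=> _ /eqP; case: q => [[j y]|[j y]] //= [->]; exists y.
have [a' ea] := inK4 _ pa; have [b' eb] := inK4 _ pb.
have [c' ec] := inK4 _ pc; have [d' ed] := inK4 _ pd; subst a b c d.
have ne y z : slot_adj (inr (i, y)) (inr (i, z)) -> y != z.
  by case/and3P=> yz _ _; apply: contraNneq yz => ->.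
have [->|ac] := eqVneq a' c'; first by constructor 1.
have [->|ad] := eqVneq a' d'; first by constructor 2.
have [->|bc] := eqVneq b' c'; first by constructor 3.
have [->|bd] := eqVneq b' d'; first by constructor 4.
have /card_uniqP u5 : uniq [:: x; a'; b'; c'; d'].
  by rewrite /= !inE !negb_or ac ad bc bd !ne.
by have := max_card [in [:: x; a'; b'; c'; d']]; rewrite u5 card_ord.
Qed.

Lemma target_bowtie_free : bowtie_free target.
Proof.
apply: bowtie_freeP => v a b c d tab tcd.
have /andP[/eqP va pa] := target_triangle tab.
have /andP[/eqP vb pb] := target_triangle (triangle_swap tab).
have /andP[_ ab] := target_triangle (triangle_rot tab).
have /andP[/eqP vc pc] := target_triangle tcd.
have /andP[/eqP vd pd] := target_triangle (triangle_swap tcd).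
have /andP[_ cd] := target_triangle (triangle_rot tcd).
have eqW (x y : point S * P) : v.1 = x.1 -> v.1 = y.1 -> x.2 = y.2 -> x = y.
  by case: x y => [x1 x2] [y1 y2] /= <- <- ->.
case: (slot_bowtie_free pa pb ab pc pd cd) => e;
  by [constructor 1; apply: eqW | constructor 2; apply: eqW |
      constructor 3; apply: eqW | constructor 4; apply: eqW].
Qed.

Definition copy_at (e : hedge S) (p : P) : point S * P := (inc e (block p), p).

(** An E_1-edge between two vertices of the copy comes from a hyperedge through
both of their blocks, and this is [e] by linearity. *)
Lemma copy_at_induced e :
  induced_copy (pattern_graph (installed_pattern e)) target (copy_at e).
Proof.
split=> [p q []//|p q]; rewrite /= /target_adj /within /pattern_adj /=.
apply/orP/orP => -[].
- by case/andP=> _; left.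
- case/existsP=> f /and3P[/= /eqP fp /eqP fq pq].
  have ef : f = e by apply: linS fp fq; apply/eqP/(pattern_block (installed_pattern f)).
  by right; rewrite -ef.
- by move=> pq; left; rewrite pq andbT; case/and3P: pq => _ /eqP ->.
- by move=> pq; right; apply/existsP; exists e; rewrite /across /= !eqxx.
Qed.
End Target.

(** * Small good subgraphs and their images among the slots *)
Section InducedSubgraph.
Variables (V : finType) (G : sgraph V) (S : {set V}).

Definition sub_adj (x y : {x | x \in S}) : bool := G (val x) (val y).

Lemma sub_adj_sym : symmetric sub_adj.
Proof. by move=> x y; exact: adj_sym. Qed.

Lemma sub_adj_irr : irreflexive sub_adj.
Proof. by move=> x; exact: adj_irr. Qed.

Definition induced_subgraph : sgraph {x | x \in S} := SGraph sub_adj_sym sub_adj_irr.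

Lemma induced_subgraph_copy : induced_copy induced_subgraph G val.
Proof. by split=> //; exact: val_inj. Qed.
End InducedSubgraph.

Lemma induced_bowtie_free (V W : Type) (H : sgraph V) (G : sgraph W) f :
  induced_copy H G f -> bowtie_free G -> bowtie_free H.
Proof.
move=> [fI fE] bf [h [hI hB]]; apply: bf; exists (f \o h).
by split=> [|x y /hB]; [exact: inj_comp | rewrite fE].
Qed.

Lemma exists_small_good_subgraph (V W : finType) (G : sgraph W) (f : V -> W) :
  good G -> exists S : {set W},
    [/\ forall v, f v \in S, #|S| <= 4 * #|V| & good (induced_subgraph G S)].
Proof.
move=> gG.
have /choice [Q HQ] : forall v, exists Q : W * W * W * W,
    seed G Q.1.1.1 Q.1.1.2 Q.1.2 Q.2 /\
    [\/ f v = Q.1.1.1, f v = Q.1.1.2, f v = Q.1.2 | f v = Q.2].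
  by move=> v; have [a [b [c [d H]]]] := good_seed (f v) gG; exists (a, b, c, d).
pose q v := [:: (Q v).1.1.1; (Q v).1.1.2; (Q v).1.2; (Q v).2].
pose S := [set w in flatten [seq q v | v : V]].
have qS v w : w \in q v -> w \in S.
  by move=> wq; rewrite inE; apply/flatten_mapP; exists v => //; exact: mem_enum.
exists S; split.
- move=> v; apply: (qS v); rewrite !inE.
  by case: (HQ v).2 => ->; rewrite eqxx ?orbT.
- rewrite cardsE (leq_trans (card_size _)) // size_flatten /shape -map_comp.
  rewrite sumnE big_map big_enum /= sum_nat_const mulnC //.
split; first exact: induced_bowtie_free (induced_subgraph_copy G S) (proj1 gG).
move=> [x xS]; have := xS; rewrite inE => /flatten_mapP[v _ xq].
have [Sa Sb Sc Sd] : [/\ (Q v).1.1.1 \in S, (Q v).1.1.2 \in S, (Q v).1.2 \in S & (Q v).2 \in S].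
  by split; apply: (qS v); rewrite !inE eqxx ?orbT.
pose s w (wS : w \in S) : {x | x \in S} := exist _ w wS.
apply: (@seed_good _ _ (s _ Sa) (s _ Sb) (s _ Sc) (s _ Sd)).
  case: (HQ v).1 => [k|tc td cd ncd]; [exact: SeedK4 | apply: SeedChimney => //].
  by move/(congr1 val).
move: xq; rewrite !inE => /or4P[] /eqP e;
  [constructor 1 | constructor 2 | constructor 3 | constructor 4]; exact: val_inj.
Qed.

Definition rank_of (V : finType) (le : rel V) (x : V) := #|[set w | le w x]|.

Lemma leq_rank_of (V : finType) (le : rel V) x y : linear_order le ->
  (rank_of le x <= rank_of le y) = le x y.
Proof.
move=> [rf asym tr tot].
have mono u v : le u v -> rank_of le u <= rank_of le v.
  move=> uv; apply/subset_leq_card/subsetP=> w; rewrite !inE => wu; exact: tr wu uv.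
apply/idP/idP; last exact: mono.
have [//|nxy] := boolP (le x y); rewrite leqNgt => /negP[].
apply: proper_card; apply/properP; split.
  apply/subsetP=> w; rewrite !inE => wy; apply: tr wy _.
  by have := tot x y; rewrite (negbTE nxy).
by exists x; rewrite !inE.
Qed.

(** The E_1-edges of [H], transported to the slots by an embedding which respects
blocks, form a pattern and make the embedding an induced one. *)
Section BlockEmbeddingPattern.
Variables (V : finType) (H : sgraph V) (n : nat) (g : V -> slot n).
Hypotheses (gH : good H) (gI : injective g).
Hypothesis g_central : forall x, slot_central (g x) = central H x.
Hypothesis g_block : forall x y, (block (g x) == block (g y)) = (centre H x == centre H y).

Definition image_pattern : {set slot n * slot n} :=
  [set pq | [exists x, exists y, edge1 H x y && (pq == (g x, g y))]].

Lemma image_patternP p q :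
  reflect (exists x y, [/\ edge1 H x y, p = g x & q = g y]) ((p, q) \in image_pattern).
Proof.
rewrite inE; apply: (iffP existsP) => [[x /existsP[y /andP[xy /eqP[-> ->]]]]|[x [y [xy -> ->]]]].
  by exists x, y.
by exists x; apply/existsP; exists y; rewrite xy eqxx.
Qed.

Lemma slot_adj_image x y : slot_adj (g x) (g y) = edge0 H x y.
Proof. by rewrite /slot_adj (edge0E gH) (inj_eq gI) g_block !g_central. Qed.

Lemma image_pattern_image x y : ((g x, g y) \in image_pattern) = edge1 H x y.
Proof.
apply/image_patternP/idP => [[x' [y' [e /gI -> /gI ->]]] //|e].
by exists x, y.
Qed.

Lemma pattern_adj_image x y : pattern_adj image_pattern (g x) (g y) = H x y.
Proof.
rewrite /pattern_adj slot_adj_image image_pattern_image /edge1.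
have : edge0 H x y -> H x y by case/edge0P => z [].
by case: (edge0 H x y) => [->|_]; rewrite ?andbT.
Qed.

(** A slot outside the image of [g] is only joined to vertices of its own block, so
it is in no triangle with an edge between two blocks. *)
Lemma image_pattern_valid : pattern image_pattern.
Proof.
split.
- move=> p q /image_patternP[x [y [xy -> ->]]]; apply/image_patternP; exists y, x.
  by split=> //; rewrite /edge1 edge0_sym adj_sym.
- move=> p q /image_patternP[x [y [/andP[xy nxy] -> ->]]] /eqP.
  by rewrite g_block => /eqP /(edge0_of_adj gH xy); apply/negP.
move=> p q s /image_patternP[x [y [xy -> ->]]] xs.
apply/negP=> ys.
have [[z sz]|nz] := pselect (exists z, s = g z).
  move: xs ys; rewrite sz !pattern_adj_image => xz yz.
  case/andP: xy => xy /negP; apply; apply/edge0P; exists z.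
  by split.
have A w : pattern_adj image_pattern (g w) s -> block (g w) = block s.
  case/orP=> [/and3P[_ /eqP //]|/image_patternP[_ [z [_ _ sz]]]].
  by case: nz; exists z.
case/andP: xy => xy /negP; apply; apply: edge0_of_adj => //.
by apply/eqP; rewrite -g_block (A x) // (A y).
Qed.
End BlockEmbeddingPattern.

Lemma adj_edge01 (V : finType) (G : sgraph V) x y : edge0 G x y || edge1 G x y = G x y.
Proof. by rewrite /edge1 /edge0; case: (G x y) => //=; case: [exists _, _]. Qed.

(** * The lift property *)
Theorem theorem8p1 (V : finType) (A : sgraph V) (hA : bowtie_free A) :
  exists (W : finType) (B : sgraph W),
    bowtie_free B /\
    forall (Ap : structure2 V) (Bp : structure2 W),
      in_Bbar Ap -> in_Bbar Bp ->
      shadow Ap =2 A -> shadow Bp =2 B ->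
      exists f : V -> W, embedding Ap Bp f.
Proof.
pose n := 4 * #|V|; pose P := slot n.
have [S [linS tfS forceS]] :=
  exists_forcing_hgraph {ffun {set P * P} -> {set P * P}} (@block n).
exists _, (target S); split; first exact: target_bowtie_free.
move=> Ap Bp [WA [GA [leA [fA [[gA aA] eA]]]]] [WB [GB [leB [fB [[gB aB] eB]]]]] _ shB.
have [T [fAT cardT gH]] := exists_small_good_subgraph fA gA.
set H := induced_subgraph GA T in gH.
pose leH (x y : {x | x \in T}) := leA (val x) (val y).
have HGA := induced_subgraph_copy GA T.
have aH : admissible H leH by apply: (admissible_map gH gA HGA) aA.
have smallH : #|{: {x | x \in T}}| <= n.+2.
  by rewrite card_sig (eq_card (B := T)) // !leqW.
pose fits (g : {x | x \in T} -> P) (L : {set P * P}) :=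
  [/\ injective g, forall x y, leH x y = ((g x, g y) \in L),
      forall x, slot_central (g x) = central H x
    & forall x y, (block (g x) == block (g y)) = (centre H x == centre H y)].
(* The embedding of [H] is chosen for every potential order [L] at once: the map
   from orders to patterns has to be fixed before the hyperedge is known. *)
have /choice [d0 Hd0] : forall L, exists E, (exists g, fits g L) ->
    exists g, fits g L /\ E = image_pattern H g.
  move=> L; have [[g Hg]|no] := pselect (exists g, fits g L).
    by exists (image_pattern H g) => _; exists g.
  by exists set0.
have BGB : induced_copy (target S) GB fB.
  have [fI _ fb] := eB; split=> // x y; rewrite -[RHS]shB /shadow -!fb.
  exact/esym/adj_edge01.
have [e [ed eL]] := forceS (fun x p => rank_of leB (fB (x, p))) set0 [ffun L => d0 L].
(* Now the guess of [e] is the order that the copy of the slots receives from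
   [leB]. *)
have {}eL p q : ((p, q) \in (lab e).1) = leB (fB (copy_at e p)) (fB (copy_at e q)).
  by rewrite eL in_setT inE leq_rank_of //; exact: adm_linear aB.
have indK := copy_at_induced linS e; set K := pattern_graph _ in indK.
have KGB : induced_copy K GB (fB \o copy_at e).
  case: indK BGB => [cI cE] [fI fE].
  by split=> [|x y]; [exact: inj_comp | rewrite /= fE cE].
have subK p q : slot_adj p q -> K p q by move=> pq; apply/orP; left.
have bfK : bowtie_free K := induced_bowtie_free KGB (proj1 gB).
have gK : good K := slot_good bfK subK (@pattern_graph_block _ _ _).
(* Whatever the E_1-edges on the copy are, the order on it is admissible; so [H]
   fits, and therefore [d0] was defined by an actual embedding. *)
have aK : admissible K (fun p q => (p, q) \in (lab e).1).
  by apply: (admissible_map gK gB KGB) aB.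
have [g Hg] : exists g, fits g (lab e).1.
  exact: (exists_block_embedding bfK subK (@pattern_graph_block _ _ _)
    (@pattern_graph_triangle _ _ _) gH aH aK smallH).
have [{Hg}g [[gI gle gc gb] Eg]] := Hd0 _ (ex_intro _ g Hg).
have inst : installed e = image_pattern H g.
  rewrite /installed /requested ed ffunE Eg; case: asboolP => // -[].
  exact: image_pattern_valid.
have HK : induced_copy H K g.
  by split=> // x y; rewrite /= inst pattern_adj_image.
have HGB : induced_copy H GB (fB \o (copy_at e \o g)).
  case: KGB HK => [kI kE] [hI hE].
  by split=> [|x y]; [exact: (inj_comp kI hI) | rewrite -hE -kE].
have L2A := L2_map gH gA HGA (leH := leH) (fun _ _ => erefl).
have L2B : embedding (L2 H leH) (L2 GB leB) (fB \o (copy_at e \o g)).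
  by apply: L2_map => // x y; rewrite gle eL.
pose f' v : {x | x \in T} := exist _ (fA v) (fAT v).
have eAH : embedding Ap (L2 H leH) f' by apply: embedding_factor L2A.
exists (copy_at e \o g \o f').
exact (embedding_factor (f := copy_at e \o g \o f') (g := fB) (embedding_comp eAH L2B) eB).
Qed.
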